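(* Let $\nu>-1/2$ and $0\leq|\beta|<\alpha$ be real numbers, let $X\sim\mathrm{VG}(\nu,\alpha,\beta,0)$, and let $k_*=\max\{-1,-2\nu-1\}$. Then, for every real $k>k_*$, $$\mathbb{E}[|X|^k]=\frac{2^k(1-\beta^2/\alpha^2)^{\nu+1/2}}{\sqrt{\pi}\,\alpha^{k}\,\Gamma(\nu+1/2)}\,\Gamma\Big(\nu+\frac{k+1}{2}\Big)\Gamma\Big(\frac{k+1}{2}\Big)\,{}_2F_1\bigg(\frac{k+1}{2},\nu+\frac{k+1}{2};\frac{1}{2};\frac{\beta^2}{\alpha^2}\bigg),$$ and, for every odd positive integer $k$, $$\mathbb{E}[X^k]=\frac{2^{k+1}\beta(1-\beta^2/\alpha^2)^{\nu+1/2}}{\sqrt{\pi}\,\alpha^{k+1}\,\Gamma(\nu+1/2)}\,\Gamma\Big(\nu+\frac{k}{2}+1\Big)\Gamma\Big(\frac{k}{2}+1\Big)\,{}_2F_1\bigg(\frac{k}{2}+1,\nu+\frac{k}{2}+1;\frac{3}{2};\frac{\beta^2}{\alpha^2}\bigg).$$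
   Context: For $\nu>-1/2$ and $0\leq|\beta|<\alpha$, the variance-gamma distribution $\mathrm{VG}(\nu,\alpha,\beta,0)$ is the probability distribution on $\mathbb{R}$ with probability density function $$p(x)=M\,\mathrm{e}^{\beta x}|x|^{\nu}K_{\nu}(\alpha|x|),\quad x\in\mathbb{R},\qquad M=\frac{(\alpha^2-\beta^2)^{\nu+1/2}}{\sqrt{\pi}(2\alpha)^\nu\,\Gamma(\nu+1/2)}.$$ Here $K_\nu$ is the modified Bessel function of the second kind, defined for $\nu\in\mathbb{R}$ and $x>0$ by $K_\nu(x)=\int_0^\infty \mathrm{e}^{-x\cosh(t)}\cosh(\nu t)\,\mathrm{d}t$. The Gaussian hypergeometric function is defined for $|x|<1$ by $${}_2F_1(a,b;c;x)=\sum_{j=0}^\infty\frac{(a)_j(b)_j}{(c)_j}\frac{x^j}{j!},$$ where $(u)_j=u(u+1)\cdots(u+j-1)$ is the ascending factorial, with $(u)_0=1$. *)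

(* Defs.v *)
From HB Require Import structures.
From mathcomp Require Import all_boot all_order all_algebra.
From mathcomp Require Import all_classical all_reals all_analysis.

Set Implicit Arguments.
Unset Strict Implicit.
Unset Printing Implicit Defensive.

Import Order.TTheory GRing.Theory Num.Theory.
Import numFieldNormedType.Exports.

Local Open Scope classical_set_scope.
Local Open Scope ring_scope.

Definition cosh {R : realType} (t : R) : R := (expR t + expR (- t)) / 2.

(* Meaningful for s > 0; the integral diverges for s <= 0, where [Rintegral]
   returns 0. *)
Definition Gamma {R : realType} (s : R) : R :=
  \int[lebesgue_measure]_(t in `]0, +oo[) (t `^ (s - 1) * expR (- t)).

(* Modified Bessel function of the second kind, meaningful for x > 0; the
   integral diverges for x <= 0, where [Rintegral] returns 0. *)
Definition besselK {R : realType} (nu x : R) : R :=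
  \int[lebesgue_measure]_(t in `[0, +oo[) (expR (- x * cosh t) * cosh (nu * t)).

Definition pochhammer {R : realType} (u : R) (j : nat) : R :=
  \prod_(i < j) (u + i%:R).

Definition hyp2F1 {R : realType} (a b c x : R) : R :=
  limn (series (fun j : nat =>
    pochhammer a j * pochhammer b j / pochhammer c j * (x ^+ j / j`!%:R))).

(* The value at x = 0 is immaterial, since [set 0] is Lebesgue-negligible. *)
Definition VG_pdf {R : realType} (nu alpha beta x : R) : R :=
  let M := (alpha ^+ 2 - beta ^+ 2) `^ (nu + 1 / 2) /
           (Num.sqrt pi * (2 * alpha) `^ nu * Gamma (nu + 1 / 2)) in
  M * expR (beta * x) * `|x| `^ nu * besselK nu (alpha * `|x|).

(* X ~ VG(nu, alpha, beta, 0): the law of X has density [VG_pdf] with respect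
   to the Lebesgue measure. *)
Definition VG_distributed {R : realType} {d : measure_display}
    {T : measurableType d} {P : probability T R} (X : {RV P >-> R})
    (nu alpha beta : R) : Prop :=
  forall A : set R, measurable A ->
    distribution P X A =
    (\int[lebesgue_measure]_(x in A) (VG_pdf nu alpha beta x)%:E)%E.

(* Main.v *)
Require Import Defs.
From HB Require Import structures.
From mathcomp Require Import all_boot all_order all_algebra.
From mathcomp Require Import all_classical all_reals all_analysis.
From mathcomp Require Import measurable_realfun ring lra.

Import Order.TTheory GRing.Theory Num.Theory.
Import numFieldNormedType.Exports.

Local Open Scope classical_set_scope.
Local Open Scope ring_scope.

(* The moments reduce to integrals over the positive half-line of the even
   (resp. odd) part of exp(beta x), i.e. cosh(beta x) or sinh(beta x), against
   x^(k + nu) K_nu(alpha x).  Both functions are of the form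
   0F1(c; (beta x)^2 / 4), up to a factor beta x for sinh, with c = 1/2 and
   c = 3/2; integrating this series term by term with the Mellin transform
     int_0^oo x^(s - 1) K_nu(c x) dx
       = 2^(s - 2) c^(-s) Gamma((s + nu) / 2) Gamma((s - nu) / 2)
   gives the 2F1 series.  The Mellin transform follows from Tonelli's theorem
   and a Beta-type integral for Gamma(a) Gamma(b).  Everything being
   nonnegative, convergence of the 2F1 series follows from finiteness of the
   integral: cosh >= 1 gives exp(|beta| x) K_nu(alpha x)
   <= K_nu((alpha - |beta|) x). *)

(** * Measurability and Lebesgue integration on the real line *)

Section measurable_comp.
Context {d : measure_display} {T : measurableType d} {R : realType}.
Implicit Types (D : set T) (f : T -> R).

(** [Rintegral] and [limn] return a default value on divergence, so each closed form hides a
    finiteness claim. Hence [egamma] and [ebesselK] live in [\bar R], and finiteness is extracted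
    from an identity proved beforehand: for Gamma from its functional equation, for K from its own
    Mellin transform, for the 2F1 series from the integral that it sums to. The Mellin transform
    dictates the parameters: x^(2j + a + b - 1) against K_(b - a) gives Gamma(a + j) Gamma(b + j) up
    to powers, and dividing by Gamma(a) Gamma(b) leaves Pochhammer symbols. The even part needs a =
    (k + 1)/2 and b = a + nu, so the lower bound on k says exactly that a and b are positive; the
    extra factor x of sinh(beta x) turns k into k + 1. The odd moment is a difference of two
    integrals, legitimate because the absolute moment of the same order is already known to be
    finite. *)

Lemma measurable_fun_powR D f (s : R) : measurable_fun D f ->
  measurable_fun D (fun x => f x `^ s).
Proof.
move=> mf; apply: (@measurableT_comp _ _ _ _ _ _ (@powR R ^~ s)) => //.
Qed.

Lemma measurable_fun_expR D f : measurable_fun D f ->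
  measurable_fun D (fun x => expR (f x)).
Proof. by move=> mf; exact: measurableT_comp. Qed.

End measurable_comp.

Section lebesgue_tools.
Context {R : realType}.
Local Open Scope ereal_scope.
Local Notation mu := (@lebesgue_measure R).

(** The pushforward of [mu] under scaling, multiplied by [c], agrees with [mu] on half-open
    intervals; uniqueness of the Lebesgue measure does the rest. *)
Lemma lebesgue_measureZ (c : R) (A : set R) : (0 < c)%R -> measurable A ->
  mu ((fun x => c * x)%R @^-1` A) = c^-1%:E * mu A.
Proof.
move=> c0 mA.
have mc : measurable_fun setT ((fun x => c * x)%R : R -> measurableTypeR R).
  exact: measurable_funM.
have c1 : (0 <= c)%R by exact: ltW.
pose m := mscale (NngNum c1) (pushforward mu ((fun x => c * x)%R : R -> measurableTypeR R)).
have : mu A = m mc A.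
  apply: lebesgue_measure_unique => //= _ [[a b]] _ <-.
  rewrite /m /mscale/= /pushforward.
  have -> : (fun x : measurableTypeR R => c * x)%R @^-1` [set` `]a, b]] =
      `](a / c)%R, (b / c)%R]%classic.
    apply/seteqP; split => x /=; rewrite !in_itv/= ltr_pdivrMr// ler_pdivlMr// ![(x * c)%R]mulrC//.
  rewrite !lebesgue_measure_itv/= !lte_fin ltr_pM2r ?invr_gt0//.
  case: ifPn => // ab; last by rewrite mule0.
  by rewrite -!EFinB -EFinM -mulrBl mulrCA divff ?gt_eqF// mulr1.
move=> ->; rewrite /m /mscale/= /pushforward muleA -EFinM mulVf ?gt_eqF//.
by rewrite mul1e.
Qed.

Lemma ge0_integralZ_preimage (c : R) (D : set R) (f : R -> \bar R) : (0 < c)%R ->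
  measurable D -> measurable_fun D f -> (forall x, D x -> 0 <= f x) ->
  \int[mu]_(x in (fun x => c * x)%R @^-1` D) f (c * x)%R =
  c^-1%:E * \int[mu]_(x in D) f x.
Proof.
move=> c0 mD mf f0.
have mc : measurable_fun setT ((fun x => c * x)%R : R -> measurableTypeR R).
  exact: measurable_funM.
have c1 : (0 <= c^-1)%R by rewrite invr_ge0 ltW.
transitivity (\int[pushforward mu ((fun x => c * x)%R : R -> measurableTypeR R)]_(x in D) f x).
  by rewrite ge0_integral_pushforward// => y /set_mem; exact: f0.
transitivity (\int[mscale (NngNum c1) mu]_(x in D) f x); last first.
  by rewrite ge0_integral_mscale.
apply: eq_measure_integral => A mA AD.
by rewrite /mscale/= /pushforward lebesgue_measureZ.
Qed.

(** The boolean [b] serves both uses: the open ray from 0 in the Gamma integral and the closed ray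
    from 1 in the substitution u = v w. *)
Lemma ge0_integralZ_itv (c : R) b (a : R) (f : R -> \bar R) : (0 < c)%R ->
  measurable_fun [set` Interval (BSide b (c * a)%R) +oo%O] f ->
  (forall x, (c * a <= x)%R -> 0 <= f x) ->
  \int[mu]_(x in [set` Interval (BSide b a) +oo%O]) f (c * x)%R =
  c^-1%:E * \int[mu]_(x in [set` Interval (BSide b (c * a)%R) +oo%O]) f x.
Proof.
move=> c0 mf f0; rewrite -ge0_integralZ_preimage//; last first.
  move=> x/=; rewrite in_itv/= andbT => h; apply: f0.
  by case: b h {mf} => //= /ltW.
congr (integral _ _ _); apply/seteqP; split => x /=; rewrite !in_itv/= !andbT;
  by case: b {mf} => /=; rewrite ?ler_pM2l ?ltr_pM2l.
Qed.

(** Tonelli on the whole plane, applied to the extension of [f] by zero outside the product. *)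
Lemma ge0_fubini_tonelli_setX (A B : set R) (f : R * R -> \bar R) :
  measurable A -> measurable B -> measurable_fun (A `*` B) f ->
  (forall x y, A x -> B y -> 0 <= f (x, y)) ->
  \int[mu]_(x in A) \int[mu]_(y in B) f (x, y) =
  \int[mu]_(y in B) \int[mu]_(x in A) f (x, y).
Proof.
move=> mA mB mf f0.
have mAB : measurable (A `*` B) by exact: measurableX.
pose g := f \_ (A `*` B).
have mg : measurable_fun setT g by apply/(measurable_restrictT f mAB).
have g0 x : 0 <= g x.
  by rewrite /g patchE; case: ifPn => // /set_mem; case: x => x y [/=]; exact: f0.
have -> : \int[mu]_(x in A) \int[mu]_(y in B) f (x, y) =
    \int[mu]_x \int[mu]_y g (x, y).
  rewrite integral_mkcond; apply: eq_integral => x _.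
  rewrite patchE; case: ifPn => xA.
    rewrite integral_mkcond; apply: eq_integral => y _.
    by rewrite /g !patchE in_setX/= xA.
  by apply/esym/integral0_eq => y _; rewrite /g patchE in_setX/= (negbTE xA).
rewrite (@fubini_tonelli _ _ _ _ _ mu mu g mg g0) [RHS]integral_mkcond.
apply: eq_integral => y _; rewrite [in RHS]patchE; case: ifPn => yB.
  rewrite [RHS]integral_mkcond; apply: eq_integral => x _.
  by rewrite /g !patchE in_setX/= yB andbT.
by apply: integral0_eq => x _; rewrite /g patchE in_setX/= (negbTE yB) andbF.
Qed.

Lemma measurable_integral_setX (A B : set R) (f : R * R -> \bar R) :
  measurable A -> measurable B -> measurable_fun (A `*` B) f ->
  (forall x y, A x -> B y -> 0 <= f (x, y)) ->
  measurable_fun A (fun x => \int[mu]_(y in B) f (x, y)).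
Proof.
move=> mA mB mf f0.
have mAB : measurable (A `*` B) by exact: measurableX.
pose g := f \_ (A `*` B).
have mg : measurable_fun setT g by apply/(measurable_restrictT f mAB).
have g0 x : 0 <= g x.
  by rewrite /g patchE; case: ifPn => // /set_mem; case: x => x y [/=]; exact: f0.
have mF := @measurable_fun_fubini_tonelli_F _ _ _ _ _ mu g mg g0.
apply: (eq_measurable_fun (fubini_F mu g)); last exact: measurable_funTS mF.
move=> x xA; rewrite /fubini_F [RHS]integral_mkcond; apply: eq_integral => y _.
by rewrite /g !patchE in_setX/= xA.
Qed.

End lebesgue_tools.

(** * Improper integrals of powers and exponentials *)

Section calculus.
Context {R : realType}.
Local Notation mu := (@lebesgue_measure R).

Lemma cvgry_ln : @ln R x @[x --> +oo] --> +oo.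
Proof.
apply/cvgryPge => A; near=> x.
by rewrite -(expRK A) ler_ln ?posrE ?expR_gt0// (lt_le_trans (expR_gt0 A)).
Unshelve. all: end_near. Qed.

Lemma cvgr_powRN (s : R) : 0 < s -> x `^ (- s) @[x --> +oo] --> (0 : R).
Proof.
move=> s0; have H : expR (- (s * ln x)) @[x --> +oo] --> (0:R).
  apply: (@cvg_comp _ _ _ (fun x => s * ln x) (fun y => expR (- y)) _ (pinfty_nbhs R)).
    by apply: gt0_cvgMry => //; exact: cvgry_ln.
  exact: cvgr_expR.
apply: cvg_trans H; apply: near_eq_cvg; near=> x.
by rewrite /powR gt_eqF// mulNr.
Unshelve. all: end_near. Qed.

Lemma gt0_powRD (x r s : R) : 0 < x -> x `^ (r + s) = x `^ r * x `^ s.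
Proof. by move=> x0; rewrite powRD// (gt_eqF x0) implybT. Qed.

Lemma gt0_powRB (x r s : R) : 0 < x -> x `^ (r - s) = x `^ r / x `^ s.
Proof. by move=> x0; rewrite powRB// (gt_eqF x0) implybT. Qed.

Lemma continuous_powR (s x : R) : 0 < x -> {for x, continuous (@powR R ^~ s)}.
Proof.
by move=> x0; apply/differentiable_continuous/derivable1_diffP; apply: ex_derive;
  exact: is_derive1_powR.
Qed.

Lemma integral_powR_ge1 (s : R) : 0 < s ->
  (\int[mu]_(x in `[1%R, +oo[) (x `^ (- s - 1))%:E = (s^-1)%:E)%E.
Proof.
move=> s0.
have dF (x : R) : 0 < x -> is_derive x 1 (fun y => - s^-1 * y `^ (- s))
    (x `^ (- s - 1)).
  move=> x0; apply: is_derive_eq.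
    by apply: is_deriveZ; exact: is_derive1_powR.
  by rewrite /GRing.scale/= mulrA mulrNN mulVf ?mul1r// gt_eqF.
rewrite (@ge0_continuous_FTC2y _ _ (fun y => - s^-1 * y `^ (- s)) _ 0).
- by rewrite powR1 mulr1 EFinN oppeK add0e.
- by move=> x _; exact: powR_ge0.
- apply: continuous_in_subspaceT => x; rewrite inE/= in_itv/= andbT => x1.
  by apply: continuous_powR; exact: lt_le_trans x1.
- rewrite -[0](mulr0 (- s^-1)); apply: cvgM; first exact: cvg_cst.
  exact: cvgr_powRN.
- by move=> x x1; apply: ex_derive; apply: dF; exact: lt_trans x1.
- apply: cvg_at_right_filter.
  suff : {for 1, continuous (fun y => - s^-1 * y `^ (- s))} by [].
  by apply/differentiable_continuous/derivable1_diffP/ex_derive/dF.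
- move=> x; rewrite in_itv/= andbT => x1.
  by rewrite derive1E; apply: derive_val; apply: dF; exact: lt_trans x1.
Qed.

Lemma integral_expRM (a t : R) : 0 < t ->
  (\int[mu]_(x in `[a, +oo[) (expR (- (x * t)))%:E = (expR (- (a * t)) / t)%:E)%E.
Proof.
move=> t0.
have dF (x : R) : is_derive x 1 (fun y => - t^-1 * expR (- (y * t)))
    (expR (- (x * t))).
  apply: is_derive_eq.
  by rewrite /GRing.scale/=; field; rewrite gt_eqF.
have dE (x : R) : derivable (fun y : R => expR (- (y * t))) x 1.
  exact: ex_derive.
rewrite (@ge0_continuous_FTC2y _ _ (fun y => - t^-1 * expR (- (y * t))) _ 0).
- by rewrite mulNr EFinN oppeK add0e mulrC.
- by move=> x _; exact: expR_ge0.
- apply: continuous_in_subspaceT => x _.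
  by apply/differentiable_continuous/derivable1_diffP.
- rewrite -[0](mulr0 (- t^-1)); apply: cvgM; first exact: cvg_cst.
  apply: (@cvg_comp _ _ _ (fun x : R => x * t) (fun y => expR (- y)) _ (pinfty_nbhs R)).
    by apply: gt0_cvgMly.
  exact: cvgr_expR.
- by move=> x x1; exact: ex_derive.
- apply: cvg_at_right_filter.
  suff : {for a, continuous (fun y : R => - t^-1 * expR (- (y * t)))} by [].
  exact/differentiable_continuous/derivable1_diffP/ex_derive.
- by move=> x _; rewrite derive1E; apply: derive_val.
Qed.

End calculus.

(** * Integration against a measure given by a density *)

Section density.
Context {R : realType}.
Local Notation mu := (@lebesgue_measure R).
Variables (m : {measure set R -> \bar R}) (p : R -> R).
Hypotheses (mp : measurable_fun setT p) (p0 : forall x, 0 <= p x).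
Hypothesis m_density : forall A, measurable A -> m A = (\int[mu]_(x in A) (p x)%:E)%E.
Import HBNNSimple.

(** The density is known on sets only. Both sides are monotone limits along simple functions
    approximating [g], and for these the claim is [m_density] on each level set. *)
Lemma ge0_integral_density (g : R -> \bar R) :
  measurable_fun setT g -> (forall x, 0 <= g x)%E ->
  (\int[m]_x g x = \int[mu]_x (g x * (p x)%:E))%E.
Proof.
move=> mg g0; pose h := nnsfun_approx measurableT mg.
have mh n : measurable_fun setT (fun x : R => h n x) by exact: measurable_funP.
have hnd a b x : (a <= b)%N -> h a x <= h b x.
  by move=> ab; exact/lefP/nd_nnsfun_approx.
have mpre n y : measurable (h n @^-1` [set y] : set R).
  by rewrite -[X in measurable X]setTI; exact: mh.
have mi n y : measurable_fun setT (\1_(h n @^-1` [set y]) : R -> R).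
  exact: measurable_indic.
have gE x : g x = limn (EFin \o h ^~ x).
  by apply/esym/cvg_lim => //; exact: cvg_nnsfun_approx.
have gpE x : (g x * (p x)%:E = limn (fun n => (h n x)%:E * (p x)%:E))%E.
  apply/esym/cvg_lim => //; apply: cvgeZr => //.
  exact: cvg_nnsfun_approx.
under eq_integral do rewrite gE.
under [RHS]eq_integral do rewrite gpE.
rewrite monotone_convergence//; last 3 first.
- by move=> n; exact/measurable_EFinP/measurable_funP.
- by move=> n x _; rewrite lee_fin.
- by move=> x _ a b ab; rewrite lee_fin hnd.
rewrite [RHS]monotone_convergence//; last 3 first.
- move=> n; apply: emeasurable_funM; last exact/measurable_EFinP.
  by apply/measurable_EFinP; exact: mh.
- by move=> n x _; rewrite mule_ge0 ?lee_fin.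
- by move=> x _ a b ab; rewrite lee_wpmul2r ?lee_fin// hnd.
congr (limn _); apply/funext => n.
rewrite /= integralT_nnsfun sintegralE.
transitivity (\int[mu]_x (\sum_(y \in range (h n))
    (y * \1_(h n @^-1` [set y]) x)%:E * (p x)%:E))%E; last first.
  apply: eq_integral => x _.
  rewrite -ge0_mule_fsuml; last by move=> y; exact: nnfun_muleindic_ge0.
  by rewrite fsumEFin//; congr (_%:E * _)%E; exact/esym/fimfunE.
rewrite ge0_integral_fsum//; last 2 first.
- move=> y; apply: emeasurable_funM; last exact/measurable_EFinP.
  by apply/measurable_EFinP; apply: measurable_funM => //; exact: mi.
- by move=> y x _; rewrite mule_ge0 ?lee_fin// -lee_fin nnfun_muleindic_ge0.
apply: eq_fsbigr => r; rewrite inE => -[t _ <-].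
under [RHS]eq_integral do rewrite EFinM -muleA.
rewrite ge0_integralZl//; last 3 first.
- apply: emeasurable_funM; last exact/measurable_EFinP.
  by apply/measurable_EFinP; exact: mi.
- by move=> x _; rewrite mule_ge0 ?lee_fin.
- by rewrite lee_fin.
congr (_ * _)%E; rewrite m_density; last exact: mpre.
rewrite [LHS]integral_mkcond; apply: eq_integral => x _.
by rewrite patchE indicE; case: (_ \in _); rewrite ?mul1e ?mul0e.
Qed.

End density.

Section fold.
Context {R : realType}.
Local Notation mu := (@lebesgue_measure R).

(** Reflection turns the second ray into the nonpositive half-line. The negligible point 0 is
    dropped so that both rays are open, where [x > 0] can be used. *)
Lemma ge0_integral_fold (F : R -> \bar R) :
  measurable_fun setT F -> (forall x, 0 <= F x)%E ->
  (\int[mu]_x F x = \int[mu]_(x in `]0%R, +oo[) F x +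
     \int[mu]_(x in `]0%R, +oo[) F (- x)%R)%E.
Proof.
move=> mF F0.
have mFN : measurable_fun setT (fun x : R => F (- x)).
  by apply: (@measurableT_comp _ _ _ _ _ _ F) => //; exact: measurable_funN.
rewrite [X in (_ = _ + X)%E]integral_itv_obnd_cbnd; last exact: measurable_funTS.
rewrite (@ge0_integration_by_substitution0 _ (fun x : R => F (- x)))//.
under [X in (_ = _ + X)%E]eq_integral do rewrite opprK.
rewrite addeC -ge0_integral_setU//=.
- by rewrite -(setUv `]-oo, 0%R]%classic) setCitvl.
- exact: measurable_funTS.
- rewrite disj_set2E; apply/eqP/seteqP; split => x //=.
  by rewrite !in_itv/= andbT => -[/le_lt_trans/[apply]]; rewrite ltxx.
Qed.

Lemma ge0_integrable_EFin (D : set R) (f : R -> R) : measurable D ->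
  measurable_fun D f -> (forall x, D x -> 0 <= f x) ->
  (\int[mu]_(x in D) (f x)%:E < +oo)%E -> mu.-integrable D (EFin \o f).
Proof.
move=> mD mf f0 foo; apply/integrableP; split; first exact/measurable_EFinP.
under eq_integral => x /set_mem Dx do rewrite /= ger0_norm ?f0//.
by [].
Qed.

End fold.

(** * The Gamma function *)

Section gamma.
Context {R : realType}.
Local Notation mu := (@lebesgue_measure R).

(* Extended-real valued, so that Tonelli applies before finiteness is known. *)
Definition egamma (s : R) : \bar R :=
  \int[mu]_(t in `]0%R, +oo[) (t `^ (s - 1) * expR (- t))%:E.

Lemma measurable_gamma_integrand (s : R) (D : set R) :
  measurable_fun D (fun t : R => t `^ (s - 1) * expR (- t)).
Proof.
apply: measurable_funTS; apply: measurable_funM; first exact: measurable_powR.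
by apply: measurable_fun_expR; exact: measurable_funN.
Qed.

Lemma egamma_ge0 (s : R) : (0 <= egamma s)%E.
Proof.
by apply: integral_ge0 => t _; rewrite lee_fin mulr_ge0 ?powR_ge0 ?expR_ge0.
Qed.

(** Write t^(s - 1) as c^(1 - s) (c t)^(s - 1); the change of variable contributes the last factor
    c^(-1). *)
Lemma egamma_scale (c s : R) : 0 < c ->
  (\int[mu]_(t in `]0%R, +oo[) (t `^ (s - 1) * expR (- (c * t)))%:E =
   (c `^ (- s))%:E * egamma s)%E.
Proof.
move=> c0.
transitivity (\int[mu]_(t in `]0%R, +oo[) ((c `^ (1 - s))%:E *
   ((fun t : R => (t `^ (s - 1) * expR (- t))%:E) (c * t)%R)))%E.
  apply: eq_integral => t; rewrite inE/= in_itv/= andbT => t0.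
  rewrite -EFinM powRM ?ltW// mulrA; congr (_%:E).
  rewrite !mulrA -(@gt0_powRD _ c)//.
  by rewrite (_ : 1 - s + _ = 0) ?powRr0 ?mul1r//; ring.
rewrite ge0_integralZl_EFin ?powR_ge0//; last 2 first.
- by move=> t _; rewrite lee_fin mulr_ge0 ?powR_ge0 ?expR_ge0.
- apply/measurable_EFinP.
  apply: (@measurableT_comp _ _ _ _ _ _ (fun t : R => t `^ (s - 1) * expR (- t))).
    exact: measurable_gamma_integrand.
  exact: measurable_funM.
rewrite (@ge0_integralZ_itv _ c false 0
  (fun t : R => (t `^ (s - 1) * expR (- t))%:E))//.
- rewrite mulr0 muleA -EFinM; congr (_%:E * _)%E.
  rewrite -powR_inv1 ?ltW// -gt0_powRD//.
  by congr (_ `^ _); ring.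
- by apply/measurable_EFinP; exact: measurable_gamma_integrand.
- by move=> t _; rewrite lee_fin mulr_ge0 ?powR_ge0 ?expR_ge0.
Qed.

(* Tonelli applied to [t ^ s e ^ (- c t)] over [t > 0] and [c >= 1], instead of an
   integration by parts, which is improper at both ends. *)
Lemma egammaS (s : R) : 0 < s -> egamma (s + 1) = (s%:E * egamma s)%E.
Proof.
move=> s0.
(* The integral over [c] equals e^(-t) / t, which lowers the exponent of [t] by one. *)
have H : egamma s = (\int[mu]_(t in `]0%R, +oo[) \int[mu]_(c in `[1%R, +oo[)
    (t `^ s * expR (- (c * t)))%:E)%E.
  apply: eq_integral => t; rewrite inE/= in_itv/= andbT => t0.
  under eq_integral do rewrite EFinM.
  rewrite ge0_integralZl_EFin ?powR_ge0//; last first.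
    apply/measurable_EFinP; apply: measurableT_comp => //.
    by apply: measurable_funN; exact: measurable_funM.
  rewrite integral_expRM// mul1r -EFinM gt0_powRB//.
  by rewrite powRr1 ?ltW// mulrAC mulrA.
rewrite H (@ge0_fubini_tonelli_setX _ _ _
  (fun z => (z.1 `^ s * expR (- (z.2 * z.1)))%:E))//; last 2 first.
- apply/measurable_EFinP; apply: measurable_funTS; apply: measurable_funM.
    exact: measurable_fun_powR.
  by apply: measurable_fun_expR; apply: measurable_funN; exact: measurable_funM.
- by move=> t c _ _; rewrite lee_fin mulr_ge0 ?powR_ge0 ?expR_ge0.
(* In the other order the integral over [t] is a scaled Gamma integral at [s + 1], and c^(-s - 1)
   integrates to 1 / s. *)
transitivity (s%:E * \int[mu]_(c in `[1%R, +oo[)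
   ((c `^ (- (s + 1)))%:E * egamma (s + 1)))%E; last first.
  congr (_ * _)%E; apply: eq_integral => c; rewrite inE/= in_itv/= andbT => c1.
  by rewrite -egamma_scale ?(lt_le_trans _ c1)// addrK.
rewrite ge0_integralZr//; last 3 first.
- by apply/measurable_EFinP; exact: measurable_fun_powR.
- by move=> c _; rewrite lee_fin powR_ge0.
- exact: egamma_ge0.
under eq_integral do rewrite opprD.
by rewrite integral_powR_ge1// muleA -EFinM divff ?mul1e// gt_eqF.
Qed.

Lemma egamma1 : egamma 1 = 1%:E.
Proof.
rewrite /egamma; under eq_integral do rewrite subrr powRr0 mul1r.
rewrite integral_itv_obnd_cbnd; last first.
  apply/measurable_EFinP.
  by apply: measurable_fun_expR; exact: measurable_funN.
have := @integral_expRM R 0 1 ltr01.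
under eq_integral do rewrite mulr1.
by move=> ->; rewrite mul0r oppr0 expR0 divr1.
Qed.

(** The functional equation gives finiteness at positive integers. The bound t^s <= 1 + t^n for n >=
    s extends it to [s + 1], away from the singularity at 0, and the functional equation brings it
    back to [s]. *)
Lemma egamma_lty (s : R) : 0 < s -> (egamma s < +oo)%E.
Proof.
move=> s0.
have nat_lty n : (egamma n.+1%:R < +oo)%E.
  elim: n => [|n ih]; first by rewrite egamma1 ltry.
  by rewrite -natr1 egammaS// lte_mul_pinfty// lee_fin.
have H : (egamma (s + 1) < +oo)%E.
  pose n := (Num.truncn s).+1.
  have sn : s <= n%:R by apply: ltW; exact: truncnS_gt.
  apply: (@le_lt_trans _ _ (egamma 1 + egamma n.+1%:R)%E); last first.
    by rewrite lte_add_pinfty// egamma1 ltry.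
  rewrite /egamma -ge0_integralD//=; last 4 first.
  - by move=> t _; rewrite lee_fin mulr_ge0 ?powR_ge0 ?expR_ge0.
  - by apply/measurable_EFinP; exact: measurable_gamma_integrand.
  - by move=> t _; rewrite lee_fin mulr_ge0 ?powR_ge0 ?expR_ge0.
  - by apply/measurable_EFinP; exact: measurable_gamma_integrand.
  apply: ge0_le_integral => //=.
  - by move=> t _; rewrite lee_fin mulr_ge0 ?powR_ge0 ?expR_ge0.
  - by apply/measurable_EFinP; exact: measurable_gamma_integrand.
  - apply: emeasurable_funD;
      by apply/measurable_EFinP; exact: measurable_gamma_integrand.
  - move=> t; rewrite in_itv/= andbT => t0.
    rewrite -EFinD lee_fin -mulrDl ler_wpM2r ?expR_ge0//.
    rewrite addrK subrr powRr0 -natr1 addrK.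
    have [t1|t1] := leP t 1.
      by rewrite (le_trans (ger_powR _ (ltW s0))) ?t0 ?powRr0 ?lerDl ?powR_ge0.
    by rewrite (le_trans (ler_powR (ltW t1) sn))// lerDr.
move: H; rewrite egammaS//; case E : (egamma s) => [r| |].
- by move=> _; rewrite ltry.
- by rewrite gt0_muley ?lte_fin.
- by [].
Qed.

(** Finiteness is essential here: [fine] would send an infinite integral to 0. *)
Lemma egammaE (s : R) : 0 < s -> egamma s = (Gamma s)%:E.
Proof.
by move=> s0; rewrite /Gamma /Rintegral fineK// ge0_fin_numE ?egamma_ge0// egamma_lty.
Qed.


Lemma GammaS (s : R) : 0 < s -> Gamma (s + 1) = s * Gamma s.
Proof.
move=> s0; apply: EFin_inj.
by rewrite EFinM -!egammaE ?addr_gt0// egammaS.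
Qed.

Lemma Gamma_pochhammer (s : R) n : 0 < s ->
  Gamma (s + n%:R) = pochhammer s n * Gamma s.
Proof.
move=> s0; elim: n => [|n ih].
  by rewrite addr0 /pochhammer big_ord0 mul1r.
rewrite -natr1 addrA GammaS ?ltr_wpDr// ih /pochhammer big_ord_recr/=.
by rewrite mulrA (mulrC (s + _)).
Qed.

End gamma.

(** * A Beta-type integral for a product of Gamma values *)

Section beta_integral.
Context {R : realType}.
Local Notation mu := (@lebesgue_measure R).
Implicit Types a b c s t u v w x y nu : R.

Let gam2 a b u v := (u `^ (a - 1) * expR (- u)) * (v `^ (b - 1) * expR (- v)).

Let gam2_ge0 a b u v : 0 <= gam2 a b u v.
Proof. by rewrite !mulr_ge0 ?powR_ge0 ?expR_ge0. Qed.

Let measurable_gam2 a b (D : set (R * R)) :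
  measurable_fun D (fun z : R * R => gam2 a b z.1 z.2).
Proof.
apply: measurable_funTS; apply: measurable_funM; apply: measurable_funM;
  by [exact: measurable_fun_powR|apply: measurable_fun_expR; exact: measurable_funN].
Qed.

Let wedge a b : \bar R := \int[mu]_(v in `]0%R, +oo[) \int[mu]_(u in `[v, +oo[)
  (gam2 a b u v)%:E.

(** Substituting u = v w at fixed [v], the Jacobian [v] merges with the two powers into v^(a + b -
    1). Integrating over [v] first is then a Gamma integral at rate 1 + w. *)
Let wedgeE a b : 0 < a -> 0 < b -> wedge a b = (egamma (a + b) *
  \int[mu]_(w in `[1%R, +oo[) (w `^ (a - 1) * (1 + w) `^ (- (a + b)))%:E)%E.
Proof.
move=> a0 b0.
transitivity (\int[mu]_(v in `]0%R, +oo[) \int[mu]_(w in `[1%R, +oo[)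
   (w `^ (a - 1) * (v `^ (a + b - 1) * expR (- ((1 + w) * v))))%:E)%E.
  apply: eq_integral => v; rewrite inE/= in_itv/= andbT => v0.
  have := @ge0_integralZ_itv _ v true 1 (fun u => (gam2 a b u v)%:E) v0.
  rewrite mulr1 => H.
  transitivity (v%:E * \int[mu]_(w in `[1%R, +oo[) (gam2 a b (v * w) v)%:E)%E.
    rewrite H; first by rewrite muleA -EFinM divff ?mul1e// lt0r_neq0.
    - apply/measurable_EFinP; apply: measurable_funM => //.
      exact: measurable_gamma_integrand.
    - by move=> u _; rewrite lee_fin.
  rewrite -ge0_integralZl_EFin ?ltW//; last 2 first.
  - by move=> u _; rewrite lee_fin.
  - apply/measurable_EFinP; apply: measurable_funM => //.
    by apply: measurable_funM; [apply: measurable_fun_powR|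
      apply: measurable_fun_expR; apply: measurable_funN]; exact: measurable_funM.
  apply: eq_integral => w; rewrite inE/= in_itv/= andbT => w1.
  rewrite -EFinM; congr (_%:E); rewrite /gam2 powRM ?ltW//; last exact: lt_le_trans w1.
  rewrite (_ : a + b - 1 = 1 + (a - 1) + (b - 1)); last by ring.
  rewrite !(@gt0_powRD _ v)// powRr1 ?ltW//.
  by rewrite (_ : - ((1 + w) * v) = - (v * w) - v) ?expRD; ring.
rewrite (@ge0_fubini_tonelli_setX _ _ _ (fun z => (z.2 `^ (a - 1) *
  (z.1 `^ (a + b - 1) * expR (- ((1 + z.2) * z.1))))%:E))//; last 2 first.
- apply/measurable_EFinP; apply: measurable_funTS; apply: measurable_funM.
    exact: measurable_fun_powR.
  apply: measurable_funM; first exact: measurable_fun_powR.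
  apply: measurable_fun_expR; apply: measurable_funN; apply: measurable_funM => //.
  exact: measurable_funD.
- by move=> v w _ _; rewrite lee_fin !mulr_ge0 ?powR_ge0 ?expR_ge0.
rewrite -ge0_integralZl//; last 3 first.
- apply/measurable_EFinP; apply: measurable_funM; apply: measurable_fun_powR => //.
  exact: measurable_funD.
- by move=> w _; rewrite lee_fin mulr_ge0 ?powR_ge0.
- exact: egamma_ge0.
apply: eq_integral => w; rewrite inE/= in_itv/= andbT => w1.
under eq_integral do rewrite EFinM.
rewrite ge0_integralZl_EFin ?powR_ge0//; last 2 first.
- by move=> v _; rewrite lee_fin mulr_ge0 ?powR_ge0 ?expR_ge0.
- apply/measurable_EFinP; apply: measurable_funM; first exact: measurable_fun_powR.
  by apply: measurable_fun_expR; apply: measurable_funN; exact: measurable_funM.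
rewrite egamma_scale; last by rewrite ltr_wpDr// (le_trans _ w1).
by rewrite EFinM muleA muleC.
Qed.


(* By symmetry, split the double integral of [u ^ (a - 1) v ^ (b - 1) e ^ (- u - v)]
   at [u = v] and substitute [u = v w]; this avoids the inversion [w -> 1 / w]. *)
Lemma egammaM a b : 0 < a -> 0 < b -> (egamma a * egamma b = egamma (a + b) *
  \int[mu]_(w in `[1%R, +oo[)
     ((w `^ (a - 1) + w `^ (b - 1)) * (1 + w) `^ (- (a + b)))%:E)%E.
Proof.
move=> a0 b0.
transitivity (wedge a b + wedge b a)%E; last first.
  rewrite !wedgeE// (addrC b a) -ge0_muleDr; last 2 first.
  - by apply: integral_ge0 => w _; rewrite lee_fin mulr_ge0 ?powR_ge0.
  - by apply: integral_ge0 => w _; rewrite lee_fin mulr_ge0 ?powR_ge0.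
  have mf (s t : R) (D : set R) : measurable_fun D (fun w => (w `^ (s - 1) * (1 + w) `^ (- t))%:E).
    apply/measurable_EFinP; apply: measurable_funM; apply: measurable_fun_powR => //.
    exact: measurable_funD.
  rewrite -ge0_integralD; last 5 first.
  - by [].
  - by move=> w _; rewrite lee_fin mulr_ge0 ?powR_ge0.
  - exact: mf.
  - by move=> w _; rewrite lee_fin mulr_ge0 ?powR_ge0.
  - exact: mf.
  by congr (_ * _)%E; apply: eq_integral => w _; rewrite mulrDl EFinD.
have mle : measurable_fun [set: R * R] (fun z : R * R => z.2 <= z.1).
  exact: measurable_fun_ler.
(* Extension by zero makes the split at the diagonal an identity of integrands on the full quadrant,
   a product set to which Tonelli applies. *)
pose lo u v := if v <= u then gam2 a b u v else 0.
pose hi u v := if v <= u then 0 else gam2 a b u v.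
have lo0 u v : 0 <= lo u v by rewrite /lo; case: ifP.
have hi0 u v : 0 <= hi u v by rewrite /hi; case: ifP.
have mlo (D : set (R * R)) : measurable_fun D (fun z => (lo z.1 z.2)%:E).
  apply/measurable_EFinP; apply: measurable_funTS.
  by apply: measurable_fun_ifT.
have mhi (D : set (R * R)) : measurable_fun D (fun z => (hi z.1 z.2)%:E).
  apply/measurable_EFinP; apply: measurable_funTS.
  by apply: measurable_fun_ifT.
have mgs (D : set R) s : measurable_fun D (fun u => (u `^ (s - 1) * expR (- u))%:E).
  by apply/measurable_EFinP; exact: measurable_gamma_integrand.
have gs0 s u : (0 <= (u `^ (s - 1) * expR (- u))%:E)%E.
  by rewrite lee_fin mulr_ge0 ?powR_ge0 ?expR_ge0.
rewrite {2}/egamma -ge0_integralZl ?egamma_ge0//; last exact: mgs.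
transitivity (\int[mu]_(v in `]0%R, +oo[) ((\int[mu]_(u in `]0%R, +oo[) (lo u v)%:E)
    + (\int[mu]_(u in `]0%R, +oo[) (hi u v)%:E)))%E.
  apply: eq_integral => v _; rewrite -ge0_integralZr ?gs0//; last exact: mgs.
  rewrite -ge0_integralD//; last 4 first.
  - by move=> u _; rewrite lee_fin.
  - by apply: measurable_funTS; exact: (measurable_fun_pair1 v (mlo setT)).
  - by move=> u _; rewrite lee_fin.
  - by apply: measurable_funTS; exact: (measurable_fun_pair1 v (mhi setT)).
  apply: eq_integral => u _; rewrite -EFinD -EFinM /lo /hi.
  by case: ifP; rewrite ?addr0 ?add0r.
have mswap (f : R -> R -> R) : measurable_fun setT (fun z : R * R => (f z.1 z.2)%:E) ->
   measurable_fun setT (fun z : R * R => (f z.2 z.1)%:E).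
  move=> mf.
  apply: (@measurableT_comp _ _ _ _ _ _
    (fun z : R * R => (f z.1 z.2)%:E) _ (fun z => (z.2, z.1))) => //.
  exact: measurable_swap.
rewrite ge0_integralD//; last 4 first.
- by move=> v _; apply: integral_ge0 => u _; rewrite lee_fin.
- apply: (@measurable_integral_setX _ _ _ (fun z => (lo z.2 z.1)%:E)) => //.
    by apply: measurable_funTS; exact: (mswap lo).
  by move=> *; rewrite lee_fin.
- by move=> v _; apply: integral_ge0 => u _; rewrite lee_fin.
- apply: (@measurable_integral_setX _ _ _ (fun z => (hi z.2 z.1)%:E)) => //.
    by apply: measurable_funTS; exact: (mswap hi).
  by move=> *; rewrite lee_fin.
congr (_ + _)%E.
  apply: eq_integral => v; rewrite inE/= in_itv/= andbT => v0.
  rewrite integral_mkcond [RHS]integral_mkcond; apply: eq_integral => u _.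
  rewrite !patchE !mem_setE !in_itv/= !andbT /lo.
  case: ifPn => [u0|]; first by case: ifP.
  by rewrite -leNgt => u0; rewrite ifF//; apply/negbTE; rewrite -ltNge (le_lt_trans u0).
(* In [wedge b a] the larger variable is the inner one; on this sector it is [v], so the order must
   be exchanged. *)
rewrite (@ge0_fubini_tonelli_setX _ _ _ (fun z => (hi z.2 z.1)%:E))//; last 2 first.
- by apply: measurable_funTS; exact: (mswap hi).
- by move=> *; rewrite lee_fin.
apply: eq_integral => u; rewrite inE/= in_itv/= andbT => u0.
(* [hi] vanishes on the diagonal while [wedge] includes it; a single endpoint is negligible. *)
rewrite -integral_itv_obnd_cbnd; last first.
  by apply/measurable_EFinP; apply: measurable_funM => //; exact: measurable_gamma_integrand.
rewrite integral_mkcond [RHS]integral_mkcond; apply: eq_integral => v _.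
rewrite !patchE !mem_setE !in_itv/= !andbT /hi.
case: ifPn => [v0|].
  by rewrite leNgt; case: ltP => //=; rewrite /gam2 mulrC.
by rewrite -leNgt => v0; rewrite ifF//; apply/negbTE; rewrite -leNgt (le_trans v0)// ltW.
Qed.

End beta_integral.

(** * The Mellin transform of the modified Bessel function *)

Section besselK_mellin.
Context {R : realType}.
Local Notation mu := (@lebesgue_measure R).
Implicit Types c s t w x nu : R.

Lemma cosh_gt0 t : 0 < cosh t.
Proof. by rewrite divr_gt0// addr_gt0// expR_gt0. Qed.

Lemma cosh_ge1 t : 1 <= cosh t.
Proof.
have e0 := expR_gt0 t; rewrite /cosh ler_pdivlMr// mul1r expRN -subr_ge0.
rewrite (_ : _ - _ = (expR t - 1) ^+ 2 / expR t); last by field; rewrite gt_eqF.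
by rewrite divr_ge0 ?sqr_ge0// ltW.
Qed.

Lemma continuous_cosh : continuous (@cosh R).
Proof.
move=> t; apply: cvgM; last exact: cvg_cst.
apply: cvgD; first exact: continuous_expR.
by apply: continuous_comp; [exact: continuousN|exact: continuous_expR].
Qed.

Lemma measurable_fun_cosh d (T : measurableType d) (D : set T) (f : T -> R) :
  measurable_fun D f -> measurable_fun D (fun z => cosh (f z)).
Proof.
move=> mf; apply: (@measurableT_comp _ _ _ _ _ _ (@cosh R)) => //.
by apply: continuous_measurable_fun; exact: continuous_cosh.
Qed.

Lemma gt0_powRE x s : 0 < x -> x `^ s = expR (s * ln x).
Proof. by move=> x0; rewrite /powR gt_eqF. Qed.

(** Substitute w = e^(2t), that is t = (ln w) / 2. Then cosh t = (1 + w) / (2 sqrt w), and the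
    result has the shape of [egammaM] with a = (s + nu)/2 and b = (s - nu)/2. *)
Lemma integral_cosh_powR nu s :
  (\int[mu]_(t in `[0%R, +oo[) (cosh (nu * t) * cosh t `^ (- s))%:E =
   (2 `^ (s - 2))%:E * \int[mu]_(w in `[1%R, +oo[)
     ((w `^ ((s + nu) / 2 - 1) + w `^ ((s - nu) / 2 - 1)) * (1 + w) `^ (- s))%:E)%E.
Proof.
pose F := fun w : R => 2^-1 * ln w; pose G := fun t => cosh (nu * t) * cosh t `^ (- s).
have isdF w : 0 < w -> is_derive w 1 F (2^-1 * w `^ (-1)).
  move=> w0; apply: is_derive_eq.
    by apply: is_deriveZ; exact: is_derive1_ln.
  by rewrite /GRing.scale/= powR_inv1// ltW.
have dF w : 0 < w -> F^`()%classic w = 2^-1 * w `^ (-1).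
  by move=> w0; rewrite derive1E; have [_ ->] := isdF _ w0.
have cdF w : 0 < w -> F^`()%classic x @[x --> w] --> F^`()%classic w.
  move=> w0; rewrite dF//; apply: (@cvg_trans _ ((2^-1 * x `^ (-1)) @[x --> w])).
    by apply: near_eq_cvg; near=> z; rewrite dF//; near: z; exact: lt_nbhsr.
  suff : {for w, continuous (fun x : R => 2^-1 * x `^ (-1))} by [].
  by apply: continuousM; [exact: cst_continuous|exact: continuous_powR].
have F1 : F 1 = 0 by rewrite /F ln1 mulr0.
transitivity (\int[mu]_(w in `[F 1%R, +oo[) (G w)%:E)%E; first by rewrite F1.
rewrite increasing_ge0_integration_by_substitutiony; last 8 first.
- move=> x y; rewrite !in_itv/= !andbT => x1 y1 xy.
  by rewrite /F ltr_pM2l ?invr_gt0// ltr_ln// posrE (lt_le_trans ltr01).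
- by move=> x; rewrite in_itv/= andbT => x1; apply: cdF; rewrite (lt_trans _ x1).
- by apply/cvg_ex; exists (F^`()%classic 1); apply: cvg_at_right_filter; exact: cdF.
- apply/cvg_ex; exists (2^-1 * 0).
  apply: (@cvg_trans _ ((2^-1 * x `^ (-1)) @[x --> +oo])).
    by apply: near_eq_cvg; near=> z; rewrite dF.
  by apply: cvgM; [exact: cvg_cst|exact: cvgr_powRN].
- split.
    move=> x; rewrite in_itv/= andbT => x1.
    by apply: ex_derive; apply: isdF; rewrite (lt_trans _ x1).
  apply: cvg_at_right_filter; suff : {for 1, continuous F} by [].
  by apply/differentiable_continuous/derivable1_diffP/ex_derive/isdF.
- by apply: gt0_cvgMry => //; exact: cvgry_ln.
- apply: continuous_subspaceT => t; apply: cvgM.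
    apply: (@continuous_comp _ _ _ (fun t => nu * t) (@cosh R)); last exact: continuous_cosh.
    exact: mulrl_continuous.
  apply: (@continuous_comp _ _ _ (@cosh R) (@powR R ^~ (- s))).
    exact: continuous_cosh.
  by apply: continuous_powR; exact: cosh_gt0.
- by move=> t _; rewrite /G mulr_ge0 ?powR_ge0// ltW// cosh_gt0.
rewrite -ge0_integralZl_EFin ?powR_ge0//; last 2 first.
- by move=> w _; rewrite lee_fin mulr_ge0 ?addr_ge0 ?powR_ge0.
- apply/measurable_EFinP; apply: measurable_funM.
    by apply: measurable_funD; exact: measurable_fun_powR.
  by apply: measurable_fun_powR; exact: measurable_funD.
apply: eq_integral => w; rewrite inE/= in_itv/= andbT => w1.
have w0 : 0 < w by rewrite (lt_le_trans _ w1).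
transitivity ((G (F w) * F^`()%classic w)%:E) => //.
rewrite -EFinM dF// /G /F; congr (_%:E).
have -> : cosh (2^-1 * ln w) = 2^-1 * w `^ (- 2^-1) * (1 + w).
  have -> : 1 + w = 1 + w `^ 2^-1 * w `^ 2^-1.
    by rewrite -gt0_powRD// (_ : 2^-1 + 2^-1 = 1) ?powRr1 ?ltW//; field.
  rewrite /cosh powRN -mulNr -!gt0_powRE// powRN.
  by field; rewrite gt_eqF// powR_gt0.
rewrite /cosh (_ : - (nu * _) = (- nu / 2) * ln w); last by field.
rewrite (_ : (nu * _) = (nu / 2) * ln w); last by field.
rewrite -!gt0_powRE// !powRM ?mulr_ge0 ?addr_ge0 ?powR_ge0 ?invr_ge0 ?(ltW w0)//.
rewrite -!powRrM.
(* The 4 cancels two halves, one from cosh(nu t) and one from dt = dw / (2w). *)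
have -> : 2^-1 `^ (- s) = 4 * 2 `^ (s - 2) :> R.
  rewrite -powR_inv1// -powRrM (_ : -1 * - s = 2 + (s - 2)); last by ring.
  by rewrite (gt0_powRD 2 2)// powR_mulrn//; ring.
rewrite (_ : (s + nu) / 2 - 1 = nu / 2 + (- 2^-1 * - s) - 1); last by field.
rewrite (_ : (s - nu) / 2 - 1 = - nu / 2 + (- 2^-1 * - s) - 1); last by field.
rewrite !(gt0_powRD w)//.
by field.
Unshelve. all: end_near. Qed.

Let measurable_besselK_integrand nu x (D : set R) :
  measurable_fun D (fun t => (expR (- x * cosh t) * cosh (nu * t))%:E).
Proof.
apply/measurable_EFinP; apply: measurable_funM.
  by apply: measurable_fun_expR; apply: measurable_funM => //; exact: measurable_fun_cosh.
by apply: measurable_fun_cosh; exact: measurable_funM.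
Qed.

Let besselK_integrand_ge0 nu x t :
  (0 <= (expR (- x * cosh t) * cosh (nu * t))%:E)%E.
Proof. by rewrite lee_fin mulr_ge0 ?expR_ge0// ltW// cosh_gt0. Qed.

Definition ebesselK nu x : \bar R :=
  \int[mu]_(t in `[0%R, +oo[) (expR (- x * cosh t) * cosh (nu * t))%:E.

Lemma ebesselK_ge0 nu x : (0 <= ebesselK nu x)%E.
Proof.
by apply: integral_ge0 => t _; rewrite lee_fin mulr_ge0 ?expR_ge0// ltW// cosh_gt0.
Qed.

Lemma measurable_ebesselK nu (D : set R) : measurable_fun D (ebesselK nu).
Proof.
apply: measurable_funTS.
apply: (@measurable_integral_setX _ _ _
  (fun z => (expR (- z.1 * cosh z.2) * cosh (nu * z.2))%:E)) => //.
  apply/measurable_EFinP; apply: measurable_funTS; apply: measurable_funM.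
    apply: measurable_fun_expR; apply: measurable_funM; first exact: measurable_funN.
    exact: measurable_fun_cosh.
  by apply: measurable_fun_cosh; exact: measurable_funM.
Qed.

(** Integrating over [x] first gives Gamma(s) (c cosh t)^(-s). The remaining integral over [t],
    times Gamma(s), is the right-hand side of [egammaM]; the bound on [nu] makes both Gamma
    arguments positive. *)
Lemma mellin_ebesselK c s nu : 0 < c -> `|nu| < s ->
  (\int[mu]_(x in `]0%R, +oo[) ((x `^ (s - 1))%:E * ebesselK nu (c * x)) =
   (2 `^ (s - 2) * c `^ (- s) * (Gamma ((s + nu) / 2) * Gamma ((s - nu) / 2)))%:E)%E.
Proof.
move=> c0; rewrite ltr_norml => /andP[nus1 nus2].
have a0 : 0 < (s + nu) / 2 by rewrite divr_gt0//; lra.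
have b0 : 0 < (s - nu) / 2 by rewrite divr_gt0//; lra.
have s0 : 0 < s by lra.
transitivity (\int[mu]_(x in `]0%R, +oo[) \int[mu]_(t in `[0%R, +oo[)
    (cosh (nu * t) * (x `^ (s - 1) * expR (- ((c * cosh t) * x))))%:E)%E.
  apply: eq_integral => x _.
  rewrite -ge0_integralZl_EFin ?powR_ge0//; last first.
    exact: measurable_besselK_integrand.
  apply: eq_integral => t _; rewrite -EFinM; congr (_%:E).
  by rewrite mulNr (mulrAC c); ring.
rewrite (@ge0_fubini_tonelli_setX _ _ _ (fun z => (cosh (nu * z.2) *
   (z.1 `^ (s - 1) * expR (- ((c * cosh z.2) * z.1))))%:E))//; last 2 first.
- apply/measurable_EFinP; apply: measurable_funTS; apply: measurable_funM.
    by apply: measurable_fun_cosh; exact: measurable_funM.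
  apply: measurable_funM; first exact: measurable_fun_powR.
  apply: measurable_fun_expR; apply: measurable_funN; apply: measurable_funM => //.
  by apply: measurable_funM => //; exact: measurable_fun_cosh.
- by move=> x t _ _; rewrite lee_fin !mulr_ge0 ?powR_ge0 ?expR_ge0// ltW// cosh_gt0.
transitivity (\int[mu]_(t in `[0%R, +oo[)
    ((c `^ (- s))%:E * egamma s * (cosh (nu * t) * cosh t `^ (- s))%:E))%E.
  apply: eq_integral => t _; under eq_integral do rewrite /= EFinM.
  rewrite ge0_integralZl_EFin ?(ltW (cosh_gt0 _))//; last 2 first.
  - by move=> x _; rewrite lee_fin mulr_ge0 ?powR_ge0 ?expR_ge0.
  - apply/measurable_EFinP; apply: measurable_funM; first exact: measurable_fun_powR.
    by apply: measurable_fun_expR; apply: measurable_funN; exact: measurable_funM.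
  have ct0 : 0 < c * cosh t by rewrite mulr_gt0// cosh_gt0.
  rewrite (egamma_scale _ _ ct0) powRM ?(ltW (cosh_gt0 _)) ?(ltW c0)//.
  by rewrite egammaE// -!EFinM; congr (_%:E); ring.
rewrite ge0_integralZl//; last 3 first.
- apply/measurable_EFinP; apply: measurable_funM.
    by apply: measurable_fun_cosh; exact: measurable_funM.
  by apply: measurable_fun_powR; exact: measurable_fun_cosh.
- by move=> t _; rewrite lee_fin mulr_ge0 ?powR_ge0// ltW// cosh_gt0.
- by rewrite mule_ge0 ?lee_fin ?powR_ge0 ?egamma_ge0.
rewrite integral_cosh_powR.
have := egammaM _ _ a0 b0; rewrite (_ : (s + nu) / 2 + (s - nu) / 2 = s); last by field.
rewrite (egammaE _ a0) (egammaE _ b0) (egammaE _ s0) => H.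
rewrite muleCA -(muleA (_ `^ (- s))%:E) -H -!EFinM; congr (_%:E); ring.
Qed.

(* [ebesselK nu] is nonincreasing, so an infinite value at [x] would make the
   Mellin transform infinite. *)
Lemma ebesselK_fin_num nu x : 0 < x -> ebesselK nu x \is a fin_num.
Proof.
move=> x0; rewrite ge0_fin_numE ?ebesselK_ge0// ltey; apply/eqP => Kx.
have anti y : y <= x -> ebesselK nu y = +oo%E.
  move=> yx; apply/eqP; rewrite -leye_eq -Kx; apply: ge0_le_integral => //.
  - exact: measurable_besselK_integrand.
  - exact: measurable_besselK_integrand.
  move=> t _; rewrite lee_fin ler_wpM2r ?(ltW (cosh_gt0 _))// ler_expR.
    by rewrite ler_wpM2r ?(ltW (cosh_gt0 _))// lerN2.
(* Any admissible exponent would do: its Mellin transform is a real number, whereas the integrand is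
   infinite on all of ]0, x]. *)
have nus : `|nu| < `|nu| + 1 by rewrite ltrDl.
have := mellin_ebesselK _ _ _ (@ltr01 R) nus; set g := fun y => (_ * _)%E.
apply/eqP; rewrite gt_eqF//.
have mg : measurable_fun setT g.
  apply: emeasurable_funM; first by apply/measurable_EFinP; exact: measurable_powR.
  apply: (@measurableT_comp _ _ _ _ _ _ (ebesselK nu)); first exact: measurable_ebesselK.
  exact: measurable_funM.
have g0 y : (0 <= g y)%E by rewrite mule_ge0 ?ebesselK_ge0// lee_fin powR_ge0.
apply: (@lt_le_trans _ _ (\int[mu]_(y in `]0%R, x]) g y)%E); last first.
  apply: ge0_subset_integral => //; first exact: measurable_funTS.
  by move=> y/=; rewrite !in_itv/= => /andP[->].
rewrite (_ : integral _ _ _ = +oo%E) ?ltry//.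
transitivity (\int[mu]_(y in `]0%R, x]) (cst +oo y))%E.
  apply: eq_integral => y; rewrite inE/= in_itv/= => /andP[y0 yx].
  by rewrite /g mul1r anti// gt0_muley// lte_fin powR_gt0.
by rewrite integral_cst//= lebesgue_measure_itv/= lte_fin x0 sube0 gt0_mulye// lte_fin.
Qed.

Lemma besselKE nu x : 0 < x -> (besselK nu x)%:E = ebesselK nu x.
Proof. by move=> x0; rewrite /besselK /Rintegral fineK// ebesselK_fin_num. Qed.

Lemma besselK_ge0 nu x : 0 <= besselK nu x.
Proof. by rewrite fine_ge0// ebesselK_ge0. Qed.

Lemma measurable_fun_besselK {d} {T : measurableType d} (D : set T) (f : T -> R) nu :
  measurable_fun D f -> measurable_fun D (fun z => besselK nu (f z)).
Proof.
move=> mf; apply: (@measurableT_comp _ _ _ _ _ _ (besselK nu)) => //.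
by apply: measurableT_comp => //; exact: measurable_ebesselK.
Qed.

Lemma mellin_besselK c s nu : 0 < c -> `|nu| < s ->
  (\int[mu]_(x in `]0%R, +oo[) (x `^ (s - 1) * besselK nu (c * x))%:E =
   (2 `^ (s - 2) * c `^ (- s) * (Gamma ((s + nu) / 2) * Gamma ((s - nu) / 2)))%:E)%E.
Proof.
move=> c0 nus; rewrite -mellin_ebesselK//; apply: eq_integral => x.
by rewrite inE/= in_itv/= andbT => x0; rewrite EFinM besselKE// mulr_gt0.
Qed.

Lemma expRM_besselK_le b c nu x : 0 <= b -> b < c -> 0 < x ->
  expR (b * x) * besselK nu (c * x) <= besselK nu ((c - b) * x).
Proof.
move=> b0 bc x0; have c0 : 0 < c by exact: le_lt_trans bc.
have cb0 : 0 < c - b by rewrite subr_gt0.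
rewrite -lee_fin EFinM !besselKE ?mulr_gt0// /ebesselK.
rewrite -ge0_integralZl_EFin ?expR_ge0//; last first.
  exact: measurable_besselK_integrand.
apply: ge0_le_integral => //.
- by move=> t _; rewrite mule_ge0 ?besselK_integrand_ge0// lee_fin expR_ge0.
- by apply: emeasurable_funM => //; exact: measurable_besselK_integrand.
- exact: measurable_besselK_integrand.
move=> t _; rewrite -EFinM lee_fin mulrA ler_wpM2r ?(ltW (cosh_gt0 _))//.
rewrite -expRD ler_expR -subr_ge0.
have -> : - ((c - b) * x) * cosh t - (b * x + - (c * x) * cosh t) =
  b * x * (cosh t - 1) by ring.
by apply: mulr_ge0; [rewrite mulr_ge0// ltW|rewrite subr_ge0 cosh_ge1].
Qed.

End besselK_mellin.

(** * Hypergeometric series and hyperbolic functions *)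

Section besselK_series.
Context {R : realType}.
Local Notation mu := (@lebesgue_measure R).

Lemma nneseries_EFin (u : nat -> R) (l : R) : series u n @[n --> \oo] --> l ->
  (\sum_(0 <= n <oo) (u n)%:E = l%:E)%E.
Proof.
move=> ul; apply/cvg_lim => //.
rewrite (_ : (fun _ => _) = EFin \o series u); last first.
  by apply/funext => n; rewrite /= /series/= sumEFin.
by apply: cvg_EFin => //; exact: nearW.
Qed.

(** Nonnegativity makes the partial sums converge in [\bar R]; since the sum is finite, convergence
    descends to [R], so [limn] is a genuine limit. *)
Lemma limn_series_EFin (u : nat -> R) (l : R) : (forall n, 0 <= u n) ->
  (\sum_(0 <= n <oo) (u n)%:E = l%:E)%E -> limn (series u) = l.
Proof.
move=> u0 ul; apply/cvg_lim => //.
have : (fun n => \sum_(0 <= i < n) (u i)%:E)%E @ \oo --> l%:E.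
  by rewrite -ul; apply: is_cvg_nneseries => n _ _; rewrite lee_fin.
move/fine_cvg; rewrite (_ : fine \o _ = series u)//.
by apply/funext => n; rewrite /= sumEFin.
Qed.

(** On [1, 2] the integrand is at least the constant [c]; the absolute value in its exponent covers
    both signs of s - 1. *)
Lemma Gamma_gt0 (s : R) : 0 < s -> 0 < Gamma s.
Proof.
move=> s0; rewrite -lte_fin -egammaE//.
pose c := (2 `^ `|s - 1|)^-1 * expR (- 2).
have c0 : 0 < c by rewrite mulr_gt0 ?invr_gt0 ?powR_gt0 ?expR_gt0.
apply: (@lt_le_trans _ _ (\int[mu]_(t in `[1%R, 2%R]) (cst c%:E t))%E).
  rewrite integral_cst//= lebesgue_measure_itv/= lte_fin ltr1n -EFinD -EFinM lte_fin.
  by rewrite mulr_gt0// subr_gt0 ltr1n.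
apply: (@le_trans _ _ (\int[mu]_(t in `[1%R, 2%R]) (t `^ (s - 1) * expR (- t))%:E)%E).
  apply: ge0_le_integral => //.
  - by move=> t _; rewrite lee_fin ltW.
  - by apply/measurable_EFinP; exact: measurable_gamma_integrand.
  move=> t; rewrite /= in_itv/= => /andP[t1 t2].
  rewrite lee_fin ler_pM ?invr_ge0 ?powR_ge0 ?expR_ge0//; last by rewrite ler_expR lerN2.
  apply: (@le_trans _ _ (t `^ (- `|s - 1|))); last first.
    by rewrite ler_powR// lerNl -normrN ler_norm.
  rewrite powRN lef_pV2 ?posrE ?powR_gt0//; last exact: lt_le_trans t1.
  by rewrite ge0_ler_powR// nnegrE// (le_trans _ t1).
apply: ge0_subset_integral => //.
- by apply/measurable_EFinP; exact: measurable_gamma_integrand.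
- by move=> t _; rewrite lee_fin mulr_ge0 ?powR_ge0 ?expR_ge0.
- by move=> t/=; rewrite !in_itv/= andbT => /andP[t1 _]; exact: lt_le_trans t1.
Qed.

Lemma pochhammer_gt0 (s : R) n : 0 < s -> 0 < pochhammer s n.
Proof. by move=> s0; apply: prodr_gt0 => i _; rewrite ltr_wpDr. Qed.

Lemma pochhammerS (s : R) n : pochhammer s n.+1 = pochhammer s n * (s + n%:R).
Proof. by rewrite /pochhammer big_ord_recr. Qed.

(* [f] plays the role of [0F1(c; (be x)^2 / 4)]. The bound on [f] is what makes
   the hypergeometric series converge. *)
Lemma integral_series_besselK (a b c al be : R) (f : R -> R) :
  0 < a -> 0 < b -> 0 < c -> `|be| < al ->
  (forall x, 0 < x -> series (fun j => (be * x / 2) ^+ j.*2 /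
     (pochhammer c j * j`!%:R)) n @[n --> \oo] --> f x) ->
  (forall x, 0 < x -> f x <= expR (`|be| * x)) ->
  (\int[mu]_(x in `]0%R, +oo[)
     (f x * (x `^ (a + b - 1) * besselK (b - a) (al * x)))%:E =
   (2 `^ (a + b - 2) * al `^ (- (a + b)) * (Gamma a * Gamma b) *
    hyp2F1 a b c (be ^+ 2 / al ^+ 2))%:E)%E.
Proof.
move=> a0 b0 c0 beal f_series f_le.
have al0 : 0 < al by exact: le_lt_trans beal.
pose t j x := (be * x / 2) ^+ j.*2 / (pochhammer c j * j`!%:R) *
  (x `^ (a + b - 1) * besselK (b - a) (al * x)).
pose h j := pochhammer a j * pochhammer b j / pochhammer c j *
  ((be ^+ 2 / al ^+ 2) ^+ j / j`!%:R).
pose C := 2 `^ (a + b - 2) * al `^ (- (a + b)) * (Gamma a * Gamma b).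
have C0 : 0 < C by rewrite !mulr_gt0 ?powR_gt0 ?Gamma_gt0.
have g0 x : 0 <= x `^ (a + b - 1) * besselK (b - a) (al * x).
  by rewrite mulr_ge0 ?powR_ge0 ?besselK_ge0.
have mg (D : set R) : measurable_fun D (fun x => x `^ (a + b - 1) * besselK (b - a) (al * x)).
  apply: measurable_funTS; apply: measurable_funM; first exact: measurable_powR.
  apply: measurable_fun_besselK.
  exact: measurable_funM.
have cj0 j : 0 < pochhammer c j * j`!%:R.
  by rewrite mulr_gt0 ?pochhammer_gt0// ltr0n fact_gt0.
have even_ge0 (y : R) j : 0 <= y ^+ j.*2 by rewrite -mul2n exprM exprn_ge0 ?sqr_ge0.
have t0 j x : 0 <= t j x by rewrite mulr_ge0// divr_ge0// ltW.
have h0 j : 0 <= h j.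
  rewrite /h !mulr_ge0 ?invr_ge0 ?exprn_ge0 ?divr_ge0 ?sqr_ge0//;
    by rewrite ltW// pochhammer_gt0.
have mt j (D : set R) : measurable_fun D (fun x => (t j x)%:E).
  apply/measurable_EFinP; apply: measurable_funM => //.
  by apply: measurable_funM => //; apply: measurable_funX; do 2 apply: measurable_funM => //.
have ft x : 0 < x -> ((f x * (x `^ (a + b - 1) * besselK (b - a) (al * x)))%:E =
    \sum_(0 <= j <oo) (t j x)%:E)%E.
  move=> x0; apply/esym/nneseries_EFin.
  rewrite (_ : series _ = (fun n => series (fun j => (be * x / 2) ^+ j.*2 /
     (pochhammer c j * j`!%:R)) n * (x `^ (a + b - 1) * besselK (b - a) (al * x)))).
    by apply: cvgM; [exact: f_series|exact: cvg_cst].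
  by apply/funext => n; rewrite /series/= mulr_suml.
have It j : (\int[mu]_(x in `]0%R, +oo[) (t j x)%:E = C%:E * (h j)%:E)%E.
  (* The [j]-th term carries x^(s - 1), and the half-sum and half-difference of [s] and [b - a] are
     [b + j] and [a + j]. *)
  pose s := j.*2%:R + (a + b).
  have nus : `|b - a| < s.
    have : (0 : R) <= j.*2%:R by [].
    by rewrite /s ltr_norml => ?; apply/andP; split; lra.
  pose k := (be / 2) ^+ j.*2 / (pochhammer c j * j`!%:R).
  transitivity (\int[mu]_(x in `]0%R, +oo[) (k%:E *
     (x `^ (s - 1) * besselK (b - a) (al * x))%:E))%E.
    apply: eq_integral => x; rewrite inE/= in_itv/= andbT => x0.
    rewrite -EFinM; congr (_%:E); rewrite /t /k /s.
    rewrite -(addrA j.*2%:R) (@gt0_powRD _ x j.*2%:R)// powR_mulrn ?ltW//.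
    by rewrite (mulrAC be) exprMn; ring.
  rewrite ge0_integralZl_EFin//; last 3 first.
  - by move=> x _; rewrite lee_fin mulr_ge0 ?powR_ge0 ?besselK_ge0.
  - apply/measurable_EFinP; apply: measurable_funM; first exact: measurable_fun_powR.
    apply: measurable_fun_besselK.
    exact: measurable_funM.
  - by rewrite /k divr_ge0// ltW.
  rewrite mellin_besselK// -!EFinM; congr (_%:E).
  rewrite (_ : (s + (b - a)) / 2 = b + j%:R); last by rewrite /s -mul2n natrM; field.
  rewrite (_ : (s - (b - a)) / 2 = a + j%:R); last by rewrite /s -mul2n natrM; field.
  rewrite !Gamma_pochhammer// /k /C /h /s.
  rewrite (opprD j.*2%:R) (@gt0_powRD _ al (- _))// powRN powR_mulrn ?ltW//.
  rewrite -(addrA j.*2%:R) (@gt0_powRD _ 2 j.*2%:R)// powR_mulrn//.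
  (* The power of 2 from the Mellin transform absorbs the halves in [be * x / 2]. *)
  have <- : (be / 2) ^+ j.*2 * 2 ^+ j.*2 * al ^- j.*2 = (be ^+ 2 / al ^+ 2) ^+ j.
    rewrite -exprVn -!exprMn -mul2n exprM; congr (_ ^+ _).
    by field; rewrite gt_eqF.
  move: (_ ^+ j.*2) (2 ^+ j.*2) (al ^- j.*2) => X Y Z.
  field.
  by rewrite !gt_eqF ?pochhammer_gt0// ltr0n fact_gt0.
have Ift : (\int[mu]_(x in `]0%R, +oo[)
     (f x * (x `^ (a + b - 1) * besselK (b - a) (al * x)))%:E =
    \int[mu]_(x in `]0%R, +oo[) \sum_(0 <= j <oo) (t j x)%:E)%E.
  by apply: eq_integral => x; rewrite inE/= in_itv/= andbT => /ft.
have : (\int[mu]_(x in `]0%R, +oo[)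
     (f x * (x `^ (a + b - 1) * besselK (b - a) (al * x)))%:E =
     C%:E * \sum_(0 <= j <oo) (h j)%:E)%E.
  rewrite Ift integral_nneseries//; last 2 first.
  - by move=> j; exact: mt.
  - by move=> j x _; rewrite lee_fin.
  under eq_eseriesr do rewrite It.
  by rewrite nneseriesZl// => j _; rewrite lee_fin.
move=> E; rewrite E.
(* The dominating Mellin transform is finite, as |b - a| < a + b for positive [a] and [b]. *)
have : (\int[mu]_(x in `]0%R, +oo[)
     (f x * (x `^ (a + b - 1) * besselK (b - a) (al * x)))%:E < +oo)%E.
  apply: (@le_lt_trans _ _ (\int[mu]_(x in `]0%R, +oo[)
      (x `^ (a + b - 1) * besselK (b - a) ((al - `|be|) * x))%:E)%E); last first.
    rewrite mellin_besselK ?ltry ?subr_gt0//.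
    by rewrite ltr_norml; apply/andP; split; lra.
  rewrite Ift; apply: ge0_le_integral => //.
  - by move=> x _; apply: nneseries_ge0 => j _ _; rewrite lee_fin.
  - apply: ge0_emeasurable_sum => [j x _ _|j _]; first by rewrite lee_fin.
    exact: mt.
  - apply/measurable_EFinP; apply: measurable_funM; first exact: measurable_fun_powR.
    apply: measurable_fun_besselK.
    exact: measurable_funM.
  move=> x; rewrite /= in_itv/= andbT => x0; rewrite -ft// lee_fin mulrCA ler_wpM2l ?powR_ge0//.
  apply: (le_trans _ (expRM_besselK_le _ _ _ _ (normr_ge0 be) beal x0)).
  by rewrite ler_wpM2r ?besselK_ge0// f_le.
rewrite E => fin; set S := (\sum_(0 <= j <oo) (h j)%:E)%E in fin *.
have S0 : (0 <= S)%E by apply: nneseries_ge0 => j _ _; rewrite lee_fin.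
(* Since C > 0, an infinite [S] would make the integral infinite. *)
have Sfin : S \is a fin_num.
  rewrite ge0_fin_numE// ltey; apply/eqP => Sy.
  by move: fin; rewrite Sy gt0_muley ?lte_fin.
have -> : hyp2F1 a b c (be ^+ 2 / al ^+ 2) = fine S.
  by apply: limn_series_EFin => //; rewrite fineK.
by rewrite -[LHS](congr1 (mule C%:E) (fineK Sfin)) -EFinM.
Qed.

End besselK_series.

(** * Hyperbolic functions as 0F1 series *)

Section hyperbolic_series.
Context {R : realType}.
Implicit Types (x y : R) (n : nat).

(** The exponential series grouped in pairs, so that combining the values at y and -y cancels one
    parity term by term and leaves a series indexed by [n] alone. *)
Let expR_pair y n := y ^+ n.*2 / n.*2`!%:R + y ^+ n.*2.+1 / n.*2.+1`!%:R.

Let cvg_series_expR_pair y : series (expR_pair y) n @[n --> \oo] --> expR y.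
Proof.
have /(@cvg_series_cvg_series_group _ _ 2) := @is_cvg_series_exp_coeff R y.
move=> /(_ isT); apply: cvg_trans.
rewrite (_ : expR_pair y = fun n => \sum_(n * 2 <= i < n.+1 * 2) exp_coeff y i)//.
by apply/funext => n; rewrite !muln2 doubleS big_ltn// big_nat1.
Qed.

Let exprN_double y n : (- y) ^+ n.*2 = y ^+ n.*2.
Proof. by rewrite -mul2n !exprM sqrrN. Qed.

Lemma cvg_series_cosh y :
  series (fun j => y ^+ j.*2 / j.*2`!%:R) n @[n --> \oo] --> cosh y.
Proof.
rewrite (_ : series _ = (fun n => (series (expR_pair y) n + series (expR_pair (- y)) n) / 2)).
  by apply: cvgM; [apply: cvgD; exact: cvg_series_expR_pair|exact: cvg_cst].
apply/funext => n; rewrite /series/= -big_split/= mulr_suml.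
apply: eq_bigr => i _; rewrite /expR_pair !exprS exprN_double.
(* Generalizing the inverse factorials spares [field] their nonvanishing conditions. *)
by move: (_ %:R^-1) (_ .+1`!%:R^-1) => u v; field.
Qed.

Lemma cvg_series_sinh y : series (fun j => y ^+ j.*2.+1 / j.*2.+1`!%:R) n
  @[n --> \oo] --> (expR y - expR (- y)) / 2.
Proof.
rewrite (_ : series _ = (fun n => (series (expR_pair y) n - series (expR_pair (- y)) n) / 2)).
  by apply: cvgM; [apply: cvgB; exact: cvg_series_expR_pair|exact: cvg_cst].
apply/funext => n; rewrite /series/= -sumrB mulr_suml.
apply: eq_bigr => i _; rewrite /expR_pair !exprS exprN_double.
by move: (_ %:R^-1) (_ .+1`!%:R^-1) => u v; field.
Qed.

(** The induction step is (2n + 2)(2n + 1) = 4 (n + 1)(n + 1/2); the case 3/2 below uses (2n + 3)(2n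
    + 2) = 4 (n + 3/2)(n + 1). *)
Lemma pochhammer_half n :
  4 ^+ n * (pochhammer (1 / 2) n * n`!%:R) = n.*2`!%:R :> R.
Proof.
elim: n => [|n ih]; first by rewrite /pochhammer big_ord0 !mulr1.
rewrite pochhammerS exprS doubleS !factS !natrM -ih -!natr1 -mul2n natrM.
by field.
Qed.

Lemma pochhammer_3half n :
  4 ^+ n * (pochhammer (3 / 2) n * n`!%:R) = n.*2.+1`!%:R :> R.
Proof.
elim: n => [|n ih]; first by rewrite /pochhammer big_ord0 !mulr1.
have -> : (n.+1.*2.+1)`! = (n.*2.+3 * n.*2.+2 * (n.*2.+1)`!)%N.
  by rewrite doubleS (factS n.*2.+2) (factS n.*2.+1) mulnA.
rewrite pochhammerS exprS factS 3!natrM -ih -!natr1 -mul2n natrM.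
by field.
Qed.

Lemma expr_half_double y n : (y / 2) ^+ n.*2 = y ^+ n.*2 / 4 ^+ n.
Proof.
by rewrite expr_div_n -[in X in _ / X]mul2n [in X in _ / X]exprM -[in X in _ / X]natrX.
Qed.

Lemma cosh_series_0F1 y : series (fun j => (y / 2) ^+ j.*2 /
  (pochhammer (1 / 2) j * j`!%:R)) n @[n --> \oo] --> cosh y.
Proof.
rewrite (_ : series _ = series (fun j => y ^+ j.*2 / j.*2`!%:R)).
  exact: cvg_series_cosh.
congr series; apply/funext => j; rewrite expr_half_double -pochhammer_half.
by rewrite [in RHS]invfM mulrA.
Qed.

Lemma sinh_series_0F1 y : y != 0 -> series (fun j => (y / 2) ^+ j.*2 /
  (pochhammer (3 / 2) j * j`!%:R)) n @[n --> \oo] --> (expR y - expR (- y)) / 2 / y.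
Proof.
move=> y0.
rewrite (_ : series _ = (fun n => series (fun j => y ^+ j.*2.+1 / j.*2.+1`!%:R) n / y)).
  by apply: cvgM; [exact: cvg_series_sinh|exact: cvg_cst].
apply/funext => n; rewrite /series/= mulr_suml; apply: eq_bigr => j _.
rewrite expr_half_double -pochhammer_3half exprSr [in RHS]invfM.
by rewrite [RHS]mulrAC mulfK// mulrA.
Qed.

Lemma cosh_le_expR y : cosh y <= expR `|y|.
Proof.
rewrite /cosh ler_pdivrMr// mulr_natr mulr2n lerD// ler_expR ?ler_norm//.
by rewrite -normrN ler_norm.
Qed.

Lemma sinh_div_ge0 y : 0 <= (expR y - expR (- y)) / 2 / y.
Proof.
have [y0|y0] := leP 0 y.
  by rewrite divr_ge0// divr_ge0// subr_ge0 ler_expR; lra.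
apply: mulr_le0; last by rewrite invr_le0 ltW.
by apply: mulr_le0_ge0 => //; rewrite subr_le0 ler_expR; lra.
Qed.

(** The left side is even, and 0 at y = 0 by the convention on inverses. For y > 0 the claim is 1 -
    e^(-2y) <= 2y. *)
Lemma sinh_div_le_expR y : (expR y - expR (- y)) / 2 / y <= expR `|y|.
Proof.
wlog y0 : y / 0 < y => [H|].
  have [/H//|y0|<-] := ltgtP 0 y; last by rewrite invr0 mulr0 expR_ge0.
  have := H (- y); rewrite opprK oppr_gt0 => /(_ y0); rewrite normrN.
  by rewrite -[X in X / 2]opprB !mulNr invrN mulrN opprK.
rewrite ler_pdivrMr// gtr0_norm// ler_pdivrMr//.
have e0 := expR_gt0 y.
have -> : expR (- y) = expR y * expR (- (2 * y)).
  by rewrite -expRD; congr expR; ring.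
have := expR_ge1Dx (- (2 * y)).
nra.
Qed.

End hyperbolic_series.

(** * Moments of the variance-gamma law *)

Section VG_density.
Context {R : realType}.
Variables nu al be : R.

Definition VG_const := (al ^+ 2 - be ^+ 2) `^ (nu + 1 / 2) /
  (Num.sqrt pi * (2 * al) `^ nu * Gamma (nu + 1 / 2)).
Local Notation M := VG_const.

Lemma VG_pdfE x : VG_pdf nu al be x =
  M * expR (be * x) * `|x| `^ nu * besselK nu (al * `|x|).
Proof. by []. Qed.

Lemma VG_pdf_pos x : 0 < x ->
  VG_pdf nu al be x = M * expR (be * x) * (x `^ nu * besselK nu (al * x)).
Proof. by move=> x0; rewrite VG_pdfE gtr0_norm// mulrA. Qed.

Lemma VG_pdf_neg x : 0 < x ->
  VG_pdf nu al be (- x) = M * expR (- (be * x)) * (x `^ nu * besselK nu (al * x)).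
Proof. by move=> x0; rewrite VG_pdfE normrN gtr0_norm// mulrN mulrA. Qed.

Lemma measurable_VG_pdf : measurable_fun setT (VG_pdf nu al be).
Proof.
rewrite (funext VG_pdfE); apply: measurable_funM.
  apply: measurable_funM; last by apply: measurable_fun_powR; exact: normr_measurable.
  by apply: measurable_funM => //; apply: measurable_fun_expR; exact: measurable_funM.
apply: measurable_fun_besselK.
by apply: measurable_funM => //; exact: normr_measurable.
Qed.

Hypotheses (hnu : - (1 / 2) < nu) (hbe : `|be| < al).

Let al0 : 0 < al. Proof. exact: le_lt_trans hbe. Qed.
Let nu0 : 0 < nu + 1 / 2. Proof. by move: hnu; lra. Qed.

Lemma VG_const_ge0 : 0 <= M.
Proof.
by rewrite divr_ge0 ?powR_ge0// !mulr_ge0 ?sqrtr_ge0 ?powR_ge0// ltW// Gamma_gt0.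
Qed.

Lemma VG_pdf_ge0 x : 0 <= VG_pdf nu al be x.
Proof.
rewrite VG_pdfE mulr_ge0 ?besselK_ge0// mulr_ge0 ?powR_ge0//.
by rewrite mulr_ge0 ?expR_ge0 ?VG_const_ge0.
Qed.

(** Normalising constant times Mellin prefactor, for s = k and s = k + 1. Factoring al^(2 nu + 1)
    out of the numerator of [M] cancels every power of [al] but al^(-s); the leading 2 undoes the
    half in cosh or sinh. *)
Lemma VG_const_powR s : 2 * M * (2 `^ (s + nu - 1) * al `^ (- (s + nu + 1))) =
  2 `^ s * (1 - be ^+ 2 / al ^+ 2) `^ (nu + 1 / 2)
       / (Num.sqrt pi * al `^ s * Gamma (nu + 1 / 2)).
Proof.
have al2 : al ^+ 2 - be ^+ 2 = al ^+ 2 * (1 - be ^+ 2 / al ^+ 2).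
  by field; rewrite gt_eqF.
have be2 : 0 <= 1 - be ^+ 2 / al ^+ 2.
  rewrite subr_ge0 ler_pdivrMr ?exprn_gt0// mul1r -[be ^+ 2]real_normK ?num_real//.
  by rewrite ler_pXn2r// ?nnegrE// ltW.
rewrite /VG_const al2 powRM ?sqr_ge0// powRM// ?(ltW al0)//.
have -> : (al ^+ 2) `^ (nu + 1 / 2) = al `^ nu * al `^ nu * al.
  rewrite -powR_mulrn ?(ltW al0)// -powRrM.
  rewrite (_ : 2 * (nu + 1 / 2) = nu + nu + 1); last by field.
  by rewrite !gt0_powRD// powRr1// ltW.
rewrite (powRN al) !(@gt0_powRD _ al)// powRr1 ?(ltW al0)//.
rewrite !(@gt0_powRD _ 2)// (powRN 2) powRr1//.
field.
by rewrite !gt_eqF ?powR_gt0 ?Gamma_gt0 ?sqrtr_gt0 ?pi_gt0.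
Qed.

End VG_density.

(** * Absolute moments *)

Section VG_abs_moment.
Context {R : realType}.
Local Notation mu := (@lebesgue_measure R).
Variables nu al be : R.
Hypotheses (hnu : - (1 / 2) < nu) (hbe : `|be| < al).
Local Notation M := (VG_const nu al be).

Lemma VG_abs_moment (k : R) : Num.max (-1) (- 2 * nu - 1) < k ->
  (\int[mu]_x ((`|x| `^ k)%:E * (VG_pdf nu al be x)%:E) =
  (2 `^ k * (1 - be ^+ 2 / al ^+ 2) `^ (nu + 1 / 2)
       / (Num.sqrt pi * al `^ k * Gamma (nu + 1 / 2))
       * Gamma (nu + (k + 1) / 2) * Gamma ((k + 1) / 2)
       * hyp2F1 ((k + 1) / 2) (nu + (k + 1) / 2) (1 / 2)
           (be ^+ 2 / al ^+ 2))%:E)%E.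
Proof.
rewrite gt_max => /andP[k1 k2].
(* Forced by b - a = nu and a + b - 1 = k + nu. *)
set a := (k + 1) / 2; set b := nu + (k + 1) / 2.
have a0 : 0 < a by rewrite /a; lra.
have b0 : 0 < b by rewrite /b; lra.
have mF : measurable_fun setT (fun x : R => ((`|x| `^ k)%:E * (VG_pdf nu al be x)%:E)%E).
  apply: emeasurable_funM; apply/measurable_EFinP; last exact: measurable_VG_pdf.
  by apply: measurable_fun_powR; exact: normr_measurable.
rewrite ge0_integral_fold//; last first.
  by move=> x; rewrite mule_ge0// lee_fin ?powR_ge0 ?VG_pdf_ge0.
rewrite -ge0_integralD//; last 4 first.
- by move=> x _; rewrite mule_ge0// lee_fin ?powR_ge0 ?VG_pdf_ge0.
- exact: measurable_funTS.
- by move=> x _; rewrite mule_ge0// lee_fin ?powR_ge0 ?VG_pdf_ge0.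
- apply: measurable_funTS; exact: (measurableT_comp mF (@oppr_measurable R setT)).
transitivity (\int[mu]_(x in `]0%R, +oo[) ((2 * M)%:E * (cosh (be * x) *
    (x `^ (a + b - 1) * besselK (b - a) (al * x)))%:E))%E.
  apply: eq_integral => x; rewrite inE/= in_itv/= andbT => x0.
  rewrite -!EFinM -EFinD; congr (_%:E).
  rewrite normrN (gtr0_norm x0) (VG_pdf_pos _ _ _ _ x0) (VG_pdf_neg _ _ _ _ x0).
  rewrite (_ : a + b - 1 = k + nu); last by rewrite /a /b; field.
  rewrite (_ : b - a = nu); last by rewrite /a /b; ring.
  by rewrite gt0_powRD// /cosh; field.
rewrite ge0_integralZl_EFin//; last 3 first.
- move=> x _; rewrite lee_fin mulr_ge0 ?(ltW (cosh_gt0 _))//.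
  by rewrite mulr_ge0 ?powR_ge0 ?besselK_ge0.
- apply/measurable_EFinP; apply: measurable_funM.
    by apply: measurable_fun_cosh; exact: measurable_funM.
  apply: measurable_funM; first exact: measurable_fun_powR.
  apply: measurable_funTS.
  apply: measurable_fun_besselK.
  exact: measurable_funM.
- by rewrite mulr_ge0 ?VG_const_ge0.
rewrite (integral_series_besselK a b (1 / 2) al be (fun x => cosh (be * x)))//; last 2 first.
- by move=> x x0; exact: cosh_series_0F1.
- move=> x x0; apply: (le_trans (cosh_le_expR _)).
  by rewrite normrM (gtr0_norm x0).
rewrite -EFinM; congr (_%:E).
rewrite -VG_const_powR// !mulrA.
rewrite (_ : a + b - 2 = k + nu - 1); last by rewrite /a /b; field.
rewrite (_ : a + b = k + nu + 1); last by rewrite /a /b; field.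
ring.
Qed.

End VG_abs_moment.

(** * Odd moments *)

Section VG_odd_moment.
Context {R : realType}.
Local Notation mu := (@lebesgue_measure R).
Variables nu al be : R.
Hypotheses (hnu : - (1 / 2) < nu) (hbe : `|be| < al).
Local Notation M := (VG_const nu al be).

(** Contributions of the two half-lines. [lower] omits the sign (-1)^k to stay nonnegative: the sum
    is the absolute moment, the difference the odd one. *)
Let upper k : \bar R := \int[mu]_(x in `]0%R, +oo[) (x ^+ k * VG_pdf nu al be x)%:E.
Let lower k : \bar R := \int[mu]_(x in `]0%R, +oo[) (x ^+ k * VG_pdf nu al be (- x))%:E.

Let measurable_upper k (D : set R) : measurable_fun D (fun x : R => x ^+ k * VG_pdf nu al be x).
Proof.
apply: measurable_funTS; apply: measurable_funM => //; exact: measurable_VG_pdf.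
Qed.

Let measurable_lower k (D : set R) : measurable_fun D (fun x : R => x ^+ k * VG_pdf nu al be (- x)).
Proof.
apply: measurable_funTS; apply: measurable_funM => //.
exact: (measurableT_comp (measurable_VG_pdf _ _ _) (@oppr_measurable R setT)).
Qed.

Let measurable_odd_integrand (e : R -> \bar R) :
  measurable_fun setT e -> measurable_fun setT (fun x => (e x * (VG_pdf nu al be x)%:E)%E).
Proof.
by move=> me; apply: emeasurable_funM => //; apply/measurable_EFinP; exact: measurable_VG_pdf.
Qed.

Let upper_lower_lty k : (upper k + lower k < +oo)%E.
Proof.
have k1 : Num.max (-1) (- 2 * nu - 1) < k%:R.
  by have := ler0n R k; move: hnu; rewrite gt_max => ? ?; apply/andP; split; lra.
have := ltry (2 `^ k%:R * (1 - be ^+ 2 / al ^+ 2) `^ (nu + 1 / 2)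
       / (Num.sqrt pi * al `^ k%:R * Gamma (nu + 1 / 2))
       * Gamma (nu + (k%:R + 1) / 2) * Gamma ((k%:R + 1) / 2)
       * hyp2F1 ((k%:R + 1) / 2) (nu + (k%:R + 1) / 2) (1 / 2)
           (be ^+ 2 / al ^+ 2)).
rewrite -VG_abs_moment// ge0_integral_fold; last 2 first.
- apply: measurable_odd_integrand; apply/measurable_EFinP.
  by apply: measurable_fun_powR; exact: normr_measurable.
- by move=> x; rewrite mule_ge0// lee_fin ?powR_ge0 ?VG_pdf_ge0.
congr (_ + _ < _)%E; apply: eq_integral => x; rewrite inE/= in_itv/= andbT => x0;
  by rewrite ?normrN (gtr0_norm x0) powR_mulrn ?(ltW x0)// EFinM.
Qed.

Let upper_ge0 k : (0 <= upper k)%E.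
Proof.
apply: integral_ge0 => x; rewrite /= in_itv/= andbT => x0.
by rewrite lee_fin mulr_ge0 ?VG_pdf_ge0// exprn_ge0// ltW.
Qed.

Let lower_ge0 k : (0 <= lower k)%E.
Proof.
apply: integral_ge0 => x; rewrite /= in_itv/= andbT => x0.
by rewrite lee_fin mulr_ge0 ?VG_pdf_ge0// exprn_ge0// ltW.
Qed.

Let upper_lty k : (upper k < +oo)%E.
Proof. exact: (le_lt_trans (leeDl _ (lower_ge0 k)) (upper_lower_lty k)). Qed.

Let lower_lty k : (lower k < +oo)%E.
Proof. exact: (le_lt_trans (leeDr _ (upper_ge0 k)) (upper_lower_lty k)). Qed.

Let integrable_upper k :
  mu.-integrable `]0%R, +oo[ (EFin \o (fun x : R => x ^+ k * VG_pdf nu al be x)).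
Proof.
apply: ge0_integrable_EFin; first exact: measurable_itv.
- exact: measurable_upper.
- move=> x; rewrite /= in_itv/= andbT => x0.
  by rewrite mulr_ge0 ?VG_pdf_ge0// exprn_ge0// ltW.
- exact: upper_lty.
Qed.

Let integrable_lower k :
  mu.-integrable `]0%R, +oo[ (EFin \o (fun x : R => x ^+ k * VG_pdf nu al be (- x))).
Proof.
apply: ge0_integrable_EFin; first exact: measurable_itv.
- exact: measurable_lower.
- move=> x; rewrite /= in_itv/= andbT => x0.
  by rewrite mulr_ge0 ?VG_pdf_ge0// exprn_ge0// ltW.
- exact: lower_lty.
Qed.

Let upper_sub_lower k : (upper k - lower k =
   (2 ^+ k.+1 * be * (1 - be ^+ 2 / al ^+ 2) `^ (nu + 1 / 2)
       / (Num.sqrt pi * al ^+ k.+1 * Gamma (nu + 1 / 2))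
       * Gamma (nu + k%:R / 2 + 1) * Gamma (k%:R / 2 + 1)
       * hyp2F1 (k%:R / 2 + 1) (nu + k%:R / 2 + 1) (3 / 2)
           (be ^+ 2 / al ^+ 2))%:E)%E.
Proof.
set a := k%:R / 2 + 1; set b := nu + k%:R / 2 + 1.
have k0 : (0 : R) <= k%:R by [].
have a0 : 0 < a by rewrite /a; lra.
have b0 : 0 < b by move: hnu; rewrite /b; lra.
have al0 : 0 < al by exact: le_lt_trans hbe.
(* [sinhc (be * x)] divides by [be * x]. For be = 0 the density is even and both sides vanish,
   finiteness of [lower k] being needed to subtract. *)
have [be0|be0] := eqVneq be 0.
  rewrite {1}be0 !(mulr0, mul0r).
  have -> : upper k = lower k.
    apply: eq_integral => x; rewrite inE/= in_itv/= andbT => x0.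
    by rewrite (VG_pdf_pos _ _ _ _ x0) (VG_pdf_neg _ _ _ _ x0) be0 !mul0r oppr0.
  have lower_fin : lower k \is a fin_num.
    rewrite (ge0_fin_numE (lower_ge0 k)); exact: lower_lty.
  exact: subee lower_fin.
have ab1 : a + b - 1 = k.+1%:R + nu by rewrite -natr1 /a /b; field.
have bnu : b - a = nu by rewrite /a /b; ring.
pose sinhc y : R := (expR y - expR (- y)) / 2 / y.
have bx0 (x : R) : 0 < x -> be * x != 0.
  by move=> x0; rewrite mulf_neq0// gt_eqF.
have I : (\int[mu]_(x in `]0%R, +oo[) (sinhc (be * x) *
    (x `^ (a + b - 1) * besselK (b - a) (al * x)))%:E =
    (2 `^ (a + b - 2) * al `^ (- (a + b)) * (Gamma a * Gamma b) *
     hyp2F1 a b (3 / 2) (be ^+ 2 / al ^+ 2))%:E)%E.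
  apply: (integral_series_besselK a b (3 / 2) al be (fun x => sinhc (be * x))) => //.
  - by move=> x x0; exact/sinh_series_0F1/bx0.
  - move=> x x0; apply: (le_trans (sinh_div_le_expR _)).
    by rewrite normrM (gtr0_norm x0).
(* Needed to pull out the constant [2 * M * be], which may be negative. *)
have intI : mu.-integrable `]0%R, +oo[ (EFin \o (fun x : R => sinhc (be * x) *
    (x `^ (a + b - 1) * besselK (b - a) (al * x)))).
  apply: ge0_integrable_EFin; first exact: measurable_itv.
  (* The quotient by [x] becomes a power -1, equal to it for x > 0 and measurable on the whole
     line. *)
  - apply: (eq_measurable_fun (fun x : R => (expR (be * x) - expR (- (be * x))) / 2 *
        (be^-1 * x `^ (-1)) * (x `^ (a + b - 1) * besselK (b - a) (al * x)))).
      move=> x; rewrite inE/= in_itv/= andbT => x0.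
      by rewrite powR_inv1 ?ltW// -invfM.
    apply: measurable_funTS; apply: measurable_funM; apply: measurable_funM.
    + apply: measurable_funM => //; apply: measurable_funB; apply: measurable_fun_expR.
        exact: measurable_funM.
      by apply: measurable_funN; exact: measurable_funM.
    + by apply: measurable_funM => //; exact: measurable_powR.
    + exact: measurable_powR.
    + apply: measurable_fun_besselK.
      exact: measurable_funM.
  - by move=> x _; rewrite mulr_ge0 ?sinh_div_ge0// mulr_ge0 ?powR_ge0 ?besselK_ge0.
  - by rewrite I ltry.
rewrite -integralB_EFin; [|by []|exact: integrable_upper|exact: integrable_lower].
transitivity (\int[mu]_(x in `]0%R, +oo[) ((2 * M * be)%:E * (sinhc (be * x) *
    (x `^ (a + b - 1) * besselK (b - a) (al * x)))%:E))%E.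
  apply: eq_integral => x; rewrite inE/= in_itv/= andbT => x0.
  rewrite -EFinB -EFinM; congr (_%:E).
  rewrite (VG_pdf_pos _ _ _ _ x0) (VG_pdf_neg _ _ _ _ x0) ab1 bnu.
  rewrite gt0_powRD// powR_mulrn ?(ltW x0)// exprS /sinhc.
  by field; rewrite be0 gt_eqF.
rewrite integralZl// I -EFinM; congr (_%:E).
rewrite -(powR_mulrn k.+1 (ltW al0)) -(@powR_mulrn _ 2 k.+1)//.
have := VG_const_powR _ _ _ hnu hbe k.+1%:R => E.
rewrite (_ : a + b - 2 = k.+1%:R + nu - 1); last by rewrite -ab1; ring.
rewrite (_ : a + b = k.+1%:R + nu + 1); last by rewrite -ab1; ring.
transitivity (be * (2 * M * (2 `^ (k.+1%:R + nu - 1) * al `^ (- (k.+1%:R + nu + 1)))) *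
  (Gamma a * Gamma b) * hyp2F1 a b (3 / 2) (be ^+ 2 / al ^+ 2)); first by ring.
by rewrite E; ring.
Qed.

(** Stated by positive and negative parts, the form in which the signed expectation is transferred
    to the density. For odd [k] these parts live on opposite half-lines. *)
Lemma VG_odd_moment k : odd k ->
  (\int[mu]_x ((fun x : R => (x ^+ k)%:E)^\+ x * (VG_pdf nu al be x)%:E) -
   \int[mu]_x ((fun x : R => (x ^+ k)%:E)^\- x * (VG_pdf nu al be x)%:E) =
   (2 ^+ k.+1 * be * (1 - be ^+ 2 / al ^+ 2) `^ (nu + 1 / 2)
       / (Num.sqrt pi * al ^+ k.+1 * Gamma (nu + 1 / 2))
       * Gamma (nu + k%:R / 2 + 1) * Gamma (k%:R / 2 + 1)
       * hyp2F1 (k%:R / 2 + 1) (nu + k%:R / 2 + 1) (3 / 2)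
           (be ^+ 2 / al ^+ 2))%:E)%E.
Proof.
move=> ok; rewrite -upper_sub_lower.
have mXk : measurable_fun setT (fun x : R => (x ^+ k)%:E).
  by apply/measurable_EFinP; exact: measurable_funX.
have XkN (x : R) : (- x) ^+ k = - x ^+ k by rewrite exprNn -signr_odd ok mulN1r.
congr (_ - _)%E.
- rewrite ge0_integral_fold; last 2 first.
  + by apply: measurable_odd_integrand; exact: measurable_funepos.
  + by move=> x; rewrite mule_ge0 ?funepos_ge0// lee_fin VG_pdf_ge0.
  rewrite [X in (_ + X)%E]integral0_eq ?adde0.
    apply: eq_integral => x; rewrite inE/= in_itv/= andbT => x0.
    by rewrite funeposE EFinM max_l// lee_fin exprn_ge0// ltW.
  move=> x; rewrite /= in_itv/= andbT => x0.
  by rewrite funeposE max_r ?mul0e// XkN lee_fin oppr_le0 exprn_ge0// ltW.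
- rewrite ge0_integral_fold; last 2 first.
  + by apply: measurable_odd_integrand; exact: measurable_funeneg.
  + by move=> x; rewrite mule_ge0 ?funeneg_ge0// lee_fin VG_pdf_ge0.
  rewrite [X in (X + _)%E]integral0_eq ?add0e.
    apply: eq_integral => x; rewrite inE/= in_itv/= andbT => x0.
    by rewrite funenegE XkN EFinN oppeK EFinM max_l// lee_fin exprn_ge0// ltW.
  move=> x; rewrite /= in_itv/= andbT => x0.
  by rewrite funenegE max_r ?mul0e// -EFinN lee_fin oppr_le0 exprn_ge0// ltW.
Qed.

End VG_odd_moment.

Theorem theorem2p1 (R : realType) (d : measure_display) (T : measurableType d)
    (P : probability T R) (X : {RV P >-> R}) (nu alpha beta : R)
    (hnu : - (1 / 2) < nu) (hbeta : `|beta| < alpha)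
    (hX : VG_distributed X nu alpha beta) :
  (forall k : R, Num.max (-1) (- 2 * nu - 1) < k ->
    'E_P[fun w => (`|X w| `^ k)%R]%E =
      (2 `^ k * (1 - beta ^+ 2 / alpha ^+ 2) `^ (nu + 1 / 2)
       / (Num.sqrt pi * alpha `^ k * Gamma (nu + 1 / 2))
       * Gamma (nu + (k + 1) / 2) * Gamma ((k + 1) / 2)
       * hyp2F1 ((k + 1) / 2) (nu + (k + 1) / 2) (1 / 2)
           (beta ^+ 2 / alpha ^+ 2))%:E)
  /\
  (forall k : nat, odd k ->
    'E_P[fun w => (X w ^+ k)%R]%E =
      (2 ^+ k.+1 * beta * (1 - beta ^+ 2 / alpha ^+ 2) `^ (nu + 1 / 2)
       / (Num.sqrt pi * alpha ^+ k.+1 * Gamma (nu + 1 / 2))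
       * Gamma (nu + k%:R / 2 + 1) * Gamma (k%:R / 2 + 1)
       * hyp2F1 (k%:R / 2 + 1) (nu + k%:R / 2 + 1) (3 / 2)
           (beta ^+ 2 / alpha ^+ 2))%:E).
Proof.
(* Pushforward by [X], then the density; signed powers are fed in through their two parts. *)
have law_integral (g : R -> \bar R) : measurable_fun setT g -> (forall x, 0 <= g x)%E ->
    (\int[P]_w (g \o X) w = \int[lebesgue_measure]_x (g x * (VG_pdf nu alpha beta x)%:E))%E.
  move=> mg g0; rewrite -ge0_integral_distribution//.
  exact: (ge0_integral_density (distribution P X) _ (measurable_VG_pdf _ _ _)
    (VG_pdf_ge0 _ _ _ hnu) hX _ mg g0).
split=> [k hk|k odd_k]; rewrite unlock.
  rewrite -(VG_abs_moment _ _ _ hnu hbeta)// -law_integral//.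
  by apply/measurable_EFinP; apply: measurable_fun_powR; exact: normr_measurable.
pose g (x : R) := (x ^+ k)%:E.
have mg : measurable_fun setT g by apply/measurable_EFinP; exact: measurable_funX.
rewrite -(VG_odd_moment _ _ _ hnu hbeta _ odd_k) integralE; congr (_ - _)%E.
- rewrite -(law_integral (g^\+)%E (measurable_funepos mg) (funepos_ge0 g)).
  by apply: eq_integral => w _; rewrite /= !funeposE.
- rewrite -(law_integral (g^\-)%E (measurable_funeneg mg) (funeneg_ge0 g)).
  by apply: eq_integral => w _; rewrite /= !funenegE.
Qed.
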